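(* Let $(X,\mu)$ be a non-atomic measure space with a dyadic grid $\mathcal{D}$, and let $\tau=1_{\mathcal{S}}$ for a sparse collection $\mathcal{S}\subset\mathcal{D}$. Let $m\geq 2$ and, for $i=1,\dots,m-1$, let $0<r_i<\infty$, $0\leq\rho_i<1$, $1<t_i<1/\rho_i$ (with $1/0=\infty$), and suppose $$\alpha:=\sum_{i=1}^{m-1} r_i(1/t_i-\rho_i)\geq 1.$$ Put $q_i:=r_i/t_i'$ for $i<m$, $q_m:=\alpha$ and $\vec q=(q_1,\dots,q_m)$. Then for every tuple of weights $\vec w=(w_1,\dots,w_m)$ and all non-negative measurable functions $f_1,\dots,f_{m-1}$ on $X$, $$\big\|\mathcal{A}^{\vec r}_{\vec\rho}(\tau,(f_1w_1,\dots,f_{m-1}w_{m-1}))\big\|_{L^{1/\alpha}(w_m)}\lesssim[\vec w]^{\vec q}\,[\vec w]_{FW}^{(r_i(1/t_i-\rho_i))_{i\neq m}}\prod_{i=1}^{m-1}\|f_i\|_{L^{t_i}(w_i)}^{r_i}.$$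
   Context: Write $|E|=\mu(E)$ for measurable $E\subset X$. A dyadic grid is a (countable) collection $\mathcal{D}$ of measurable subsets of $X$ (''cubes'') with $0<|Q|<\infty$ such that for all $Q,Q'\in\mathcal{D}$ either $Q\subseteq Q'$, $Q'\subseteq Q$ or $Q\cap Q'=\emptyset$. All functions are non-negative. A weight is a non-negative measurable function on $X$; $L^p(w)$ is the Lebesgue space with respect to the measure $w\,d\mu$. $t'=t/(t-1)$, and $(w)_Q=|Q|^{-1}\int_Q w\,d\mu$. A collection $\mathcal{S}\subset\mathcal{D}$ is $\eta$-sparse ($0<\eta\le 1$) if there are pairwise disjoint measurable subsets $E(Q)\subset Q$, $Q\in\mathcal{S}$, with $|E(Q)|\geq\eta|Q|$; it is sparse if it is $\eta$-sparse for some fixed $\eta$. Equivalently, $\tau=1_{\mathcal{S}}$ satisfies $\|\tau\|_{\mathrm{Car}}:=\sup_{Q\in\mathcal{D}}|Q|^{-1}\sum_{Q'\in\mathcal{D},\,Q'\subseteq Q}\tau_{Q'}|Q'|\le 1/\eta$. Sparse operator: $$\mathcal{A}^{\vec r}_{\vec\rho}(\tau,(g_1,\dots,g_{m-1}))=\sum_{Q\in\mathcal{D}}\tau_Q\prod_{i=1}^{m-1}\Big(|Q|^{-(1-\rho_i)}\int_Q g_i\,d\mu\Big)^{r_i}1_Q.$$ For exponents $r_1,\dots,r_k\ge0$ let $\mathcal{M}^{\vec r}(f_1,\dots,f_k)(x)=\sup_{Q\in\mathcal{D},\,x\in Q}\prod_{i=1}^k\big(|Q|^{-1}\int_Q f_i\,d\mu\big)^{r_i}$;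 a factor with exponent $0$ is omitted. Multilinear Muckenhoupt characteristic: for $\vec q=(q_1,\dots,q_m)$ with $0\le q_i<\infty$, $[\vec w]^{\vec q}=\sup_{Q\in\mathcal{D}}\prod_{i=1}^m (w_i)_Q^{q_i}$. Multilinear Fujii--Wilson characteristic: for $\vec\beta=(\beta_1,\dots,\beta_m)$ with $0\le\beta_i<\infty$ and $\beta=\sum_i\beta_i$, $$[\vec w]_{FW}^{\vec\beta}=\sup_{Q\in\mathcal{D}}\Big(\int_Q \mathcal{M}^{\vec\beta/\beta}(1_Qw_1,\dots,1_Qw_m)\,d\mu\Big)^{\beta}\Big(\int_Q\prod_{i=1}^m w_i^{\beta_i/\beta}\,d\mu\Big)^{-\beta}.$$ $(\beta_i)_{i\neq j}$ denotes the vector of length $m$ whose $i$-th entry is $\beta_i$ for $i\neq j$ and $0$ for $i=j$. $A\lesssim B$ means $A\le CB$ with $C$ depending only on $m,\vec r,\vec\rho,\vec t$ and the sparsity/Carleson constant of $\mathcal{S}$ (not on $X,\mu,\mathcal{D}$, the weights or the functions). *)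

(* Defs.v *)
From HB Require Import structures.
From mathcomp Require Import all_boot all_order all_algebra.
From mathcomp Require Import all_classical all_reals all_analysis.
From mathcomp Require Import measurable_realfun.

Set Implicit Arguments.
Unset Strict Implicit.
Unset Printing Implicit Defensive.

Import Order.TTheory GRing.Theory Num.Theory.

Local Open Scope classical_set_scope.
Local Open Scope ring_scope.
Local Open Scope ereal_scope.

(* Functions are measurable with values in [0, +oo], a subset of \bar R; the
   library convention 0 * +oo = 0 is used throughout, and x `^ 0 = 1 for every
   x, so that factors with exponent 0 are omitted. *)

Section Grids.
Context d (X : measurableType d) (R : realType).
Variable mu : {measure set X -> \bar R}.

Definition nonatomic : Prop :=
  forall A, measurable A -> 0 < mu A ->
    exists B, [/\ measurable B, B `<=` A, 0 < mu B & mu B < mu A].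

Definition dyadic_grid (D : set (set X)) : Prop :=
  [/\ countable D,
      forall Q, D Q -> measurable Q,
      forall Q, D Q -> 0 < mu Q /\ mu Q < +oo &
      forall Q Q', D Q -> D Q' ->
        [\/ Q `<=` Q', Q' `<=` Q | Q `&` Q' = set0]].

Definition sparse (eta : R) (S : set (set X)) : Prop :=
  exists E : set X -> set X,
    [/\ forall Q, S Q -> measurable (E Q),
        forall Q, S Q -> E Q `<=` Q,
        forall Q, S Q -> eta%:E * mu Q <= mu (E Q) &
        trivIset S E].

End Grids.

Section Weights.
Context d (X : measurableType d) (R : realType).

Definition nonneg_measurable (f : X -> \bar R) : Prop :=
  measurable_fun [set: X] f /\ forall x, 0 <= f x.

(* The measure w dmu, so that 'N[wmeasure mu hw]_p%:E[f] is the norm of f in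
   L^p(w). *)
Definition wmeasure (mu : {measure set X -> \bar R}) (w : X -> \bar R)
    (hw : nonneg_measurable w) : set X -> \bar R :=
  fun A => \int[mu]_(x in A) w x.

Section Instance.
Variables (mu : {measure set X -> \bar R}) (w : X -> \bar R).
Hypothesis hw : nonneg_measurable w.

Let wmeasure0 : wmeasure mu hw set0 = 0.
Proof. exact: integral_set0. Qed.

Let wmeasure_ge0 A : 0 <= wmeasure mu hw A.
Proof. by apply: integral_ge0 => x _; exact: hw.2. Qed.

Let wmeasure_sigma_additive : semi_sigma_additive (wmeasure mu hw).
Proof. exact: semi_sigma_additive_nng_induced hw.1 hw.2. Qed.

HB.instance Definition _ := isMeasure.Build _ _ _ (wmeasure mu hw)
  wmeasure0 wmeasure_ge0 wmeasure_sigma_additive.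
End Instance.

End Weights.

Section Operators.
Context d (X : measurableType d) (R : realType).
Variables (mu : {measure set X -> \bar R}) (D : set (set X)).

Definition average (Q : set X) (f : X -> \bar R) : \bar R :=
  (mu Q)^-1 * \int[mu]_(x in Q) f x.

(* Supremum in [0, +oo]; the empty set has supremum 0 and not -oo. *)
Definition nnsup (A : set (\bar R)) : \bar R := ereal_sup (0 |` A).

Definition sparse_op n (r rho : 'I_n -> R) (tau : set X -> R)
    (g : 'I_n -> X -> \bar R) (x : X) : \bar R :=
  \esum_(Q in D)
    ((tau Q)%:E *
     \prod_(i < n) (mu Q `^ (- (1 - rho i)) * \int[mu]_(y in Q) g i y) `^ r i *
     (\1_Q x)%:E).

Definition maximal_op k (r : 'I_k -> R) (f : 'I_k -> X -> \bar R) (x : X) :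
    \bar R :=
  nnsup [set \prod_(i < k) average Q (f i) `^ r i
        | Q in [set Q | D Q /\ Q x]].

Definition muckenhoupt k (q : 'I_k -> R) (w : 'I_k -> X -> \bar R) : \bar R :=
  nnsup [set \prod_(i < k) average Q (w i) `^ q i | Q in D].

(* a / b with c / 0 = +oo for c > 0 and 0 / 0 = 0 (library conventions), but
   +oo / +oo = 1 instead of the library's 0: in fujii_wilson, Hoelder's
   inequality on Q gives b <= a, so a quotient 0 with a > 0 would be spurious. *)
Definition quotient (a b : \bar R) : \bar R :=
  if (a == +oo) && (b == +oo) then 1 else a / b.

Definition fujii_wilson k (beta : 'I_k -> R) (w : 'I_k -> X -> \bar R) :
    \bar R :=
  let b := (\sum_(i < k) beta i)%R in
  nnsup [set quotient
      ((\int[mu]_(x in Q)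
          maximal_op (fun i => beta i / b)%R
            (fun i y => (\1_Q y)%:E * w i y) x) `^ b)
      ((\int[mu]_(x in Q) \prod_(i < k) w i x `^ (beta i / b)) `^ b)
    | Q in D].

End Operators.

Definition conj_exp (R : realType) (t : R) : R := (t / (t - 1))%R.

(* The vector (v_0, ..., v_{n-1}, c); lift ord_max i is i seen in 'I_n.+1. *)
Definition snoc (T : Type) n (v : 'I_n -> T) (c : T) : 'I_n.+1 -> T :=
  fun i => if unlift ord_max i is Some j then v j else c.

(* Main.v *)
Require Import Defs.
From HB Require Import structures.
From mathcomp Require Import all_boot all_order all_algebra.
From mathcomp Require Import all_classical all_reals all_analysis.
From mathcomp Require Import measurable_realfun.
From mathcomp Require Import ring lra.

(** Write p = 1/alpha <= 1, theta_i = beta_i/alpha, W_i(Q) = int_Q w_i dmu and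
    c_i(Q) for the average of f_i over Q with respect to w_i dmu. As p <= 1,
    the p-th power of the left-hand side is at most the sum over Q in S of
    w_m(Q) times the p-th powers of the coefficients. Hoelder's inequality
    |int_Q f_i w_i| <= N_i W_i(Q)^(1/t_i'), with N_i = t_i' ||f_i||, absorbs the
    fractional powers |Q|^rho_i, and the Muckenhoupt characteristic removes
    w_m(Q); since sum_i theta_i = 1, what is left is a constant times
      sum_Q prod_i W_i(Q)^theta_i * prod_i c_i(Q)^(t_i theta_i).
    The disjoint sets E(Q) and the Fujii-Wilson characteristic make
    prod_i W_i(Q)^theta_i a Carleson sequence for the measure
    prod_i w_i^theta_i dmu, so the sum is at most the integral against this
    measure of the supremum over Q of the second product. Hoelder's inequality
    with exponents 1/theta_i splits it into the dyadic maximal functions of f_i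
    in L^(t_i)(w_i), which Doob's inequality bounds. *)

Set Implicit Arguments.
Unset Strict Implicit.
Unset Printing Implicit Defensive.

Import Order.TTheory GRing.Theory Num.Theory.
Local Open Scope classical_set_scope.
Local Open Scope ring_scope.

(** * Integration against a density *)

Section Integration.
Context d (X : measurableType d) (R : realType).
Local Open Scope ereal_scope.
Implicit Types (mu : {measure set X -> \bar R}) (f g w : X -> \bar R).

(* Unlike [ge0_le_integral], this applies to [maximal_op] without a proof that
   it is measurable. *)
Lemma le_ge0_integral mu (A : set X) f g :
  (forall x, A x -> 0 <= f x) -> (forall x, A x -> f x <= g x) ->
  \int[mu]_(x in A) f x <= \int[mu]_(x in A) g x.
Proof.
move=> f0 fg.
have g0 x : A x -> 0 <= g x by move=> Ax; exact: le_trans (f0 _ Ax) (fg _ Ax).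
rewrite !ge0_integralE//.
apply: le_ereal_sup => _ [h /= hf <-]; exists h => //= x.
by apply: le_trans (hf x) _; exact: lee_restrict.
Qed.

Section Density.
Import HBNNSimple.
Variables (mu : {measure set X -> \bar R}) (w : X -> \bar R).
Hypothesis hw : nonneg_measurable w.

Let integral_wmeasure_nnsfun (h : {nnsfun X >-> R}) :
  sintegral (wmeasure mu hw) h = \int[mu]_x ((h x)%:E * w x).
Proof.
rewrite sintegralE.
under eq_integral => x _.
  rewrite fimfunE -fsumEFin// ge0_mule_fsuml; last first.
    by move=> y; rewrite lee_fin; exact: nnfun_muleindic_ge0.
  over.
rewrite ge0_integral_fsum//=; last 2 first.
- move=> y; apply: emeasurable_funM; last exact: hw.1.
  apply/measurable_EFinP; exact: measurable_funM.
- move=> y x _; apply: mule_ge0; last exact: hw.2.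
  by rewrite lee_fin; exact: nnfun_muleindic_ge0.
apply: eq_fsbigr => y /[!inE] -[x _ <-].
under eq_integral do rewrite EFinM -muleA.
rewrite ge0_integralZl_EFin//; last 2 first.
- by move=> z _; apply: mule_ge0; [rewrite lee_fin|exact: hw.2].
- apply: emeasurable_funM; last exact: hw.1.
  by apply/measurable_EFinP/measurable_indic.
congr (_ * _); rewrite /wmeasure integral_mkcond.
by apply: eq_integral => z _; rewrite epatch_indic muleC.
Qed.

(** For simple [f] this is linearity; the general case follows by monotone convergence on both sides
    along [nnsfun_approx]. *)
Lemma ge0_integral_wmeasure f : nonneg_measurable f ->
  \int[wmeasure mu hw]_x f x = \int[mu]_x (f x * w x).
Proof.
move=> [mf f0].
pose g := nnsfun_approx measurableT mf.
have ndg x : nondecreasing_seq (fun n => g n x).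
  by move=> m n mn; exact/lefP/nd_nnsfun_approx.
have gf x : EFin \o (fun n => g n x) @ \oo --> f x by exact: cvg_nnsfun_approx.
rewrite (nd_ge0_integral_lim _ f0 ndg gf).
under [RHS]eq_integral => x _.
  rewrite (_ : f x * w x = limn (fun n => (g n x)%:E * w x)); first over.
  apply/esym/cvg_lim => //; have w0 := hw.2 x.
  have [wfin|] := boolP (w x \is a fin_num); first by apply: cvgeZr => //; exact: gf.
  rewrite ge0_fin_numE// -leNgt leye_eq => /eqP wy.
  (* When [w x] is infinite, multiplication by it is not continuous at 0. If [f x] is 0, every
     approximation already vanishes at [x]; otherwise the product of the limits is defined. *)
  have [fx0|fx0] := eqVneq (f x) 0.
    rewrite fx0 mul0e (_ : (fun _ => _) = cst 0); first exact: cvg_cst.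
    apply/funext => n; suff -> : g n x = 0%R by rewrite mul0e.
    apply/eqP; rewrite eq_le fun_ge0 andbT.
    suff : (g n x)%:E <= f x by rewrite fx0 lee_fin.
    have <- := cvg_lim _ (gf x) => //.
    have -> : limn (EFin \o g ^~ x) = ereal_sup (range (EFin \o g ^~ x)).
      apply/cvg_lim => //; apply: ereal_nondecreasing_cvgn => p q pq /=.
      by rewrite lee_fin ndg.
    by apply: ereal_sup_ubound; exists n.
  apply: cvgeM; [|exact: gf|exact: cvg_cst].
  by rewrite wy /mule_def; case: (f x) fx0 => //= r; rewrite eqe.
rewrite [RHS](@monotone_convergence _ _ _ mu _ measurableT
  (fun n x => (g n x)%:E * w x))//.
- congr (limn _); apply/funext => n /=; exact: integral_wmeasure_nnsfun.
- by move=> n; apply: emeasurable_funM; [exact/measurable_EFinP|exact: hw.1].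
- by move=> n x _; apply: mule_ge0; [rewrite lee_fin|exact: hw.2].
- by move=> x _ m n mn; apply: lee_wpmul2r; [exact: hw.2|rewrite lee_fin ndg].
Qed.

Lemma ge0_integral_wmeasure_in (A : set X) f : measurable A ->
  nonneg_measurable f ->
  \int[wmeasure mu hw]_(x in A) f x = \int[mu]_(x in A) (f x * w x).
Proof.
move=> mA [mf f0]; have hf : nonneg_measurable (f \_ A).
  split; first by apply/(measurable_restrictT _ _).1 => //; exact: measurable_funTS.
  by move=> x; apply: erestrict_ge0 => y _.
rewrite [LHS]integral_mkcond; apply: etrans (ge0_integral_wmeasure hf) _.
rewrite [RHS]integral_mkcond; apply: eq_integral => x _.
by rewrite !patchE; case: ifP; rewrite ?mul0e.
Qed.

End Density.
End Integration.

(** * Convexity inequalities for powers *)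

Section Powers.
Context (R : realType).

(** Dividing by the weighted mean [S] turns the claim into [prod (x_i/S)^theta_i <= 1]. This follows
    from [y <= exp (y - 1)], because the exponents [theta_i (x_i/S - 1)] sum to 0. *)
Lemma weighted_amgm n (theta x : 'I_n -> R) :
  (forall i, 0 < theta i) -> \sum_(i < n) theta i = 1 -> (forall i, 0 <= x i) ->
  \prod_(i < n) x i `^ theta i <= \sum_(i < n) theta i * x i.
Proof.
case: n theta x => [|n] theta x theta0 theta1 x0.
  by move/esym/eqP: theta1; rewrite !big_ord0 oner_eq0.
set S := \sum_(i < n.+1) theta i * x i.
have tx0 i : 0 <= theta i * x i by rewrite mulr_ge0// ltW.
have [S0|S0] := eqVneq S 0.
  have /eqP : x ord0 = 0.
    apply/eqP; have /eqP := S0; rewrite psumr_eq0// => /allP/(_ ord0).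
    by rewrite mem_index_enum mulf_eq0 gt_eqF//= => /(_ isT).
  by rewrite S0 big_ord_recl => /eqP ->; rewrite powR0 ?mul0r// gt_eqF.
have {S0}S0 : 0 < S by rewrite lt0r S0 sumr_ge0.
have SE : S = \prod_(i < n.+1) S `^ theta i.
  under eq_bigr do rewrite /powR gt_eqF//.
  by rewrite -expR_sum -mulr_suml theta1 mul1r lnK.
have -> : \prod_(i < n.+1) x i `^ theta i = S * \prod_(i < n.+1) (x i / S) `^ theta i.
  rewrite {1}SE -big_split/=; apply: eq_bigr => i _.
  rewrite -powRM; [|exact: ltW|by rewrite divr_ge0// ltW].
  by rewrite mulrC divfK ?gt_eqF.
rewrite ler_piMr ?(ltW S0)//.
apply: (@le_trans _ _ (\prod_(i < n.+1) expR (theta i * (x i / S - 1)))).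
  apply: ler_prod => i _; rewrite powR_ge0/=.
  have y0 : 0 <= x i / S by rewrite divr_ge0// ltW.
  rewrite [theta i * _]mulrC expRM ge0_ler_powR ?nnegrE ?expR_ge0 ?(ltW (theta0 i))//.
  by have := expR_ge1Dx (x i / S - 1); rewrite addrC subrK.
rewrite -expR_sum -[leRHS]expR0 ler_expR.
under eq_bigr do rewrite mulrBr mulr1 mulrA.
by rewrite sumrB theta1 -mulr_suml divff ?gt_eqF// subrr.
Qed.

Lemma ge0_weighted_amgm n (theta : 'I_n -> R) (x : 'I_n -> \bar R) :
  (forall i, 0 < theta i) -> \sum_(i < n) theta i = 1 ->
  (forall i, 0 <= x i)%E ->
  (\prod_(i < n) x i `^ theta i <= \sum_(i < n) (theta i)%:E * x i)%E.
Proof.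
move=> theta0 theta1 x0.
have tx0 i : (0 <= (theta i)%:E * x i)%E by rewrite mule_ge0// lee_fin ltW.
have [[i xi]|xfin] := pselect (exists i, x i = +oo%E).
  rewrite [leRHS](bigD1 i)//= xi gt0_muley ?lte_fin// addye ?leey//.
  by rewrite gt_eqF// (lt_le_trans ltNy0)// sume_ge0.
have {}xfin i : x i = (fine (x i))%:E.
  rewrite fineK// ge0_fin_numE// ltey; apply/eqP => xi.
  by apply: xfin; exists i.
under eq_bigr do rewrite xfin poweR_EFin.
under [leRHS]eq_bigr do rewrite xfin -EFinM.
rewrite prodEFin sumEFin lee_fin weighted_amgm// => i.
by rewrite fine_ge0.
Qed.

(** Young's inequality for [a] and [b^(p-1)], cleared of denominators. *)
Lemma young_powR (p a b : R) : 1 < p -> 0 <= a -> 0 <= b ->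
  p * (a * b `^ (p - 1)) <= a `^ p + (p - 1) * b `^ p.
Proof.
move=> p1 a0 b0; have p0 : 0 < p by apply: lt_trans p1.
have q0 : 0 < p / (p - 1) by rewrite divr_gt0// subr_gt0.
have p10 : p - 1 != 0 by rewrite gt_eqF// subr_gt0.
have := @conjugate_powR R a (b `^ (p - 1)) p (p / (p - 1)) a0 (powR_ge0 _ _) p0 q0.
rewrite -powRrM mulrCA divff ?mulr1//.
have -> : p^-1 + (p / (p - 1))^-1 = 1 by field; rewrite p10 gt_eqF.
move=> /(_ erefl) /(ler_pM (ltW p0) (mulr_ge0 a0 (powR_ge0 _ _)) (lexx p)).
move/le_trans; apply; rewrite mulrDr mulrCA divff ?gt_eqF// mulr1 lerD2l.
by rewrite le_eqVlt; apply/orP; left; apply/eqP; field; rewrite p10 gt_eqF.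
Qed.

(** Young's inequality with [a] and [b] exchanged. It trades layers of a p-th power for layers of a
    (p-1)-th power in the proof of Doob's inequality. *)
Lemma powR_increment (p a b : R) : 1 < p -> 0 <= a -> 0 <= b ->
  b `^ p - a `^ p <= conj_exp p * (b * (b `^ (p - 1) - a `^ (p - 1))).
Proof.
move=> p1 a0 b0; have p0 : 0 < p - 1 by rewrite subr_gt0.
rewrite /conj_exp mulrAC ler_pdivlMr//.
have bE : b * b `^ (p - 1) = b `^ p.
  have [->|b1] := eqVneq b 0; first by rewrite mul0r powR0// gt_eqF// (lt_trans _ p1).
  rewrite -{1}[b]powRr1// -powRD ?subrKC//.
  by rewrite b1 implybT.
have := young_powR p1 b0 a0; rewrite [b * (_ - _)]mulrBr bE; lra.
Qed.
End Powers.

(** * Finite nested families of sets *)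

Section NestedFamilies.
Context d (X : measurableType d) (R : realType).
Implicit Types (s t : seq (set X)) (c : set X -> R) (phi : R -> R).

Definition nested s := {in s &, forall Q Q' : set X,
  [\/ Q `<=` Q', Q' `<=` Q | Q `&` Q' = set0]}.

Definition cover s : set X := \bigcup_(Q in [set` s]) Q.

(** The dyadic maximal function of the coefficients [c] over the finite family [s]; the starting
    value 0 is its value off [cover s]. *)
Definition max_on c s (x : X) : R := \big[Num.max/0]_(Q <- s) (c Q * \1_Q x).

Lemma exists_maximal s : s != [::] ->
  exists2 Q : set X, Q \in s & forall Q', Q' \in s -> Q `<=` Q' -> Q' = Q.
Proof.
elim: s => // P [|P' s] IH _.
  by exists P; rewrite ?mem_head// => Q'; rewrite inE => /eqP.
have [//|Q Qs maxQ] := IH.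
have [QP|QP] := pselect (Q `<=` P).
  exists P; first exact: mem_head.
  move=> Q'; rewrite inE => /predU1P[//|Q's] PQ'.
  have Q'Q := maxQ _ Q's (subset_trans QP PQ').
  by apply/seteqP; split=> //; rewrite Q'Q.
exists Q; first by rewrite inE Qs orbT.
by move=> Q'; rewrite inE => /predU1P[->//|]; exact: maxQ.
Qed.

Lemma measurable_cover s : {in s, forall Q, measurable Q} ->
  measurable (cover s).
Proof. by move=> ms; apply: fin_bigcup_measurable => // Q /= /ms. Qed.

Lemma cover_cons Q s : cover (Q :: s) = Q `|` cover s.
Proof.
apply/seteqP; split=> x.
  by case=> P /=; rewrite inE => /predU1P[->|Ps] Px; [left|right; exists P].
by case=> [Qx|[P /= Ps Px]]; [exists Q|exists P]; rewrite //= inE ?eqxx// Ps orbT.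
Qed.

Lemma cover_filter (P : pred (set X)) s :
  cover s = cover (seq.filter P s) `|` cover (seq.filter (predC P) s).
Proof.
apply/seteqP; split=> x; last first.
  by case=> -[Q /=]; rewrite mem_filter => /andP[_ Qs] Qx; exists Q.
move=> [Q /= Qs Qx]; have [PQ|PQ] := boolP (P Q).
  by left; exists Q => //=; rewrite mem_filter PQ.
by right; exists Q => //=; rewrite mem_filter /= PQ.
Qed.

(* The maximal members of a finite nested family are disjoint and cover the
   rest, so it suffices to compare [V] and [nu] below a single member. *)
Lemma nested_cover_le (nu : {measure set X -> \bar R})
    (V : seq (set X) -> \bar R) s :
  nested s -> {in s, forall Q, measurable Q} ->
  (V [::] <= 0)%E ->
  (forall (P : pred (set X)) t, uniq t -> {subset t <= s} ->
    V t <= V (seq.filter P t) + V (seq.filter (predC P) t))%E ->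
  (forall Q t, Q \in s -> uniq t -> {subset t <= s} ->
    {in t, forall Q', Q' `<=` Q} -> V t <= nu Q)%E ->
  uniq s -> (V s <= nu (cover s))%E.
Proof.
move=> ns ms V0 Vsplit Vloc us.
suff H k t : (size t <= k)%N -> uniq t -> {subset t <= s} ->
    (V t <= nu (cover t))%E by exact: (H (size s)).
elim: k t => [|k IH] t.
  by rewrite leqn0 size_eq0 => /eqP -> _ _; apply: le_trans V0 _.
have [->//|t0] := eqVneq t [::].
  by move=> _ _ _; apply: le_trans V0 _.
move=> tk ut ts; have [Q Qt maxQ] := exists_maximal t0.
(* Split off the members inside the maximal set [Q]. The remaining list is shorter, and by
   maximality its members are disjoint from [Q], so induction and additivity of [nu] apply. *)
pose P (Q' : set X) := `[< Q' `<=` Q >].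
have sub p : {subset seq.filter p t <= s}.
  by move=> Q'; rewrite mem_filter => /andP[_ /ts].
have mt p : {in seq.filter p t, forall Q', measurable Q'} by move=> Q' /sub /ms.
apply: le_trans (Vsplit P t ut ts) _.
have V1 : (V (seq.filter P t) <= nu Q)%E.
  apply: Vloc; [exact: ts|exact: filter_uniq|exact: sub|].
  by move=> Q'; rewrite mem_filter => /andP[/asboolP].
have V2 : (V (seq.filter (predC P) t) <= nu (cover (seq.filter (predC P) t)))%E.
  apply: IH; [|exact: filter_uniq|exact: sub].
  rewrite -ltnS (leq_trans _ tk)// size_filter -(count_predC P t) -[ltnLHS]add0n.
  rewrite ltn_add2r -has_count; apply/hasP; exists Q => //; exact/asboolP.
apply: le_trans (leeD V1 V2) _.
rewrite -measureU; [|exact/ms/ts|exact: measurable_cover|].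
- apply: le_measure; rewrite ?inE.
  + by apply: measurableU; [exact/ms/ts|exact: measurable_cover].
  + by apply: measurable_cover => Q' /ts /ms.
  + move=> x [Qx|[Q' /=]]; first by exists Q.
    by rewrite mem_filter => /andP[_ Q't] Q'x; exists Q'.
- rewrite -subset0 => x [Qx [Q' /=]]; rewrite mem_filter /= => /andP[PQ' Q't] Q'x.
  have [QQ'|Q'Q|dis] := ns _ _ (ts _ Qt) (ts _ Q't).
  + by case/negP: PQ'; apply/asboolP; rewrite (maxQ _ Q't QQ').
  + by case/negP: PQ'; apply/asboolP.
  + by have : (Q `&` Q') x by []; rewrite dis.
Qed.

Lemma max_on_ge0 c s x : 0 <= max_on c s x.
Proof.
rewrite /max_on; elim: s => [|Q s IH]; first by rewrite big_nil.
by rewrite big_cons le_max IH orbT.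
Qed.

Lemma le_max_on c s Q x : Q \in s -> Q x -> c Q <= max_on c s x.
Proof.
move=> + Qx; rewrite /max_on; elim: s => // P s IH.
rewrite inE big_cons le_max => /predU1P[<-|/IH->]; last by rewrite orbT.
by rewrite indicE mem_set// mulr1 lexx.
Qed.

Lemma max_on_attained c s x : max_on c s x = 0 \/
  exists Q, [/\ Q \in s, Q x & max_on c s x = c Q].
Proof.
rewrite /max_on; elim: s => [|P s IH]; first by left; rewrite big_nil.
rewrite big_cons; case: (leP (c P * \1_P x) (\big[Num.max/0]_(Q <- s) (c Q * \1_Q x))) => _.
  by case: IH => [->|[Q [Qs Qx ->]]]; [left|right; exists Q; rewrite inE Qs orbT].
rewrite indicE; have [|] := boolP (x \in P); last by rewrite mulr0; left.
by rewrite inE mulr1 => Px; right; exists P; rewrite mem_head.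
Qed.

Lemma max_on_notin c s x : ~ cover s x -> max_on c s x = 0.
Proof.
move=> sx; have [//|[Q [Qs Qx _]]] := max_on_attained c s x.
by exfalso; apply: sx; exists Q.
Qed.

Lemma eq_max_on c s t x : s =i t -> max_on c s x = max_on c t x.
Proof.
have H s1 s2 : {subset s1 <= s2} -> max_on c s1 x <= max_on c s2 x.
  move=> ss; have [->|[Q [Qs Qx ->]]] := max_on_attained c s1 x.
    exact: max_on_ge0.
  by apply: le_max_on => //; exact: ss.
by move=> st; apply/le_anti; rewrite !H// => Q; rewrite st.
Qed.

Lemma measurable_max_on c s : {in s, forall Q, measurable Q} ->
  measurable_fun setT (max_on c s).
Proof.
elim: s => [|Q s IH] ms.
  by rewrite (_ : max_on _ _ = cst 0)//; apply/funext => x; rewrite /max_on big_nil.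
rewrite (_ : max_on _ _ = fun x => Num.max (c Q * \1_Q x) (max_on c s x)); last first.
  by apply/funext => x; rewrite /max_on big_cons.
apply: measurable_maxr; last by apply: IH => P Ps; apply: ms; rewrite inE Ps orbT.
by apply: measurable_funM => //; apply: measurable_indic; apply: ms; exact: mem_head.
Qed.

End NestedFamilies.

(** * Layer-cake sums over finite families ordered by their coefficients *)

Section LayerCake.
Context d (X : measurableType d) (R : realType) (c : set X -> R).
Local Open Scope ereal_scope.
Implicit Types (s t : seq (set X)) (V : seq (set X) -> \bar R) (p lam : R).

(* When [c] increases along [s], [max_on c s] is at least [c Q] exactly on the
   union of the members of [s] from [Q] on: this is a finite layer cake. *)
Fixpoint layer_sum p lam s V : \bar R :=
  if s is Q :: t then
    (c Q `^ p - lam `^ p)%:E * V s + layer_sum p (c Q) t V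
  else 0.

Definition increasing_from lam s := path <=%R lam (map c s).

Lemma increasing_from_ge lam s Q : increasing_from lam s -> Q \in s ->
  (lam <= c Q)%R.
Proof.
rewrite /increasing_from (path_sortedE le_trans) => /andP[/allP H _] Qs.
by apply: H; exact: map_f.
Qed.

Let powR_incr p lam Q : (0 < p)%R -> (0 <= lam)%R -> (lam <= c Q)%R ->
  (0 <= c Q `^ p - lam `^ p)%R.
Proof.
move=> p0 l0 lQ; rewrite subr_ge0 ge0_ler_powR ?nnegrE ?(ltW p0)//.
exact: le_trans lQ.
Qed.

Lemma layer_sum_ge0 p lam s V : (0 < p)%R -> (0 <= lam)%R ->
  increasing_from lam s -> (forall t, 0 <= V t) -> 0 <= layer_sum p lam s V.
Proof.
move=> p0 + + V0; elim: s lam => //= Q s IH lam l0 /andP[lQ Qs].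
apply: adde_ge0; first by rewrite mule_ge0// lee_fin powR_incr.
by apply: IH => //; exact: le_trans lQ.
Qed.

Lemma layer_sum_fin_num p lam s V :
  (forall t, {subset t <= s} -> V t \is a fin_num) ->
  layer_sum p lam s V \is a fin_num.
Proof.
elim: s lam => //= Q s IH lam Vfin.
rewrite fin_numD fin_numM ?Vfin//= IH// => t ts.
by apply: Vfin => P /ts; rewrite inE => ->; rewrite orbT.
Qed.

(** The tails whose cover contains [x] form an initial segment of the tails, ending at the last set
    that contains [x]. The increments telescope up to the coefficient of that set, which is the
    largest one at [x]. *)
Lemma layer_sum_indic p lam s x : (0 < p)%R -> (0 <= lam)%R ->
  increasing_from lam s ->
  layer_sum p lam s (fun t => (\1_(cover t) x)%:E) =
  ((max_on c s x `^ p - lam `^ p) * \1_(cover s) x)%:E.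
Proof.
move=> p0; elim: s lam => [|Q s IH] lam l0 /=.
  by rewrite /cover set_nil bigcup_set0 indicE in_set0 mulr0.
move=> /andP[lQ Qs]; have Q0 : (0 <= c Q)%R by exact: le_trans lQ.
rewrite IH// -EFinM -EFinD; congr EFin.
rewrite cover_cons !indicE in_setU.
have maxE : max_on c (Q :: s) x = Num.max (c Q * \1_Q x)%R (max_on c s x).
  by rewrite /max_on big_cons.
have [xs|xs] := boolP (x \in cover s).
  suff -> : max_on c (Q :: s) x = max_on c s x by rewrite orbT !mulr1; ring.
  rewrite maxE; apply/max_idPr; move: xs; rewrite inE => -[P /= Ps Px].
  apply: le_trans (le_max_on c Ps Px); apply: le_trans (increasing_from_ge Qs Ps).
  by rewrite indicE; case: (_ \in _); rewrite ?mulr1// mulr0.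
have ms0 : max_on c s x = 0%R.
  by apply: max_on_notin => /mem_set; apply/negP.
rewrite maxE ms0 indicE orbF; have [xQ|_] := boolP (x \in Q).
  by rewrite mulr0 addr0 !mulr1 (max_idPl _).
by rewrite !mulr0 addr0.
Qed.

(** Summation by parts: [a Q] is counted once in each tail up to the one starting at [Q], and those
    increments add up to [c Q - lam]. *)
Lemma layer_sum_sum lam s (a : set X -> \bar R) : (0 <= lam)%R ->
  increasing_from lam s -> (forall Q, 0 <= a Q) ->
  layer_sum 1 lam s (fun t => \sum_(Q <- t) a Q) =
  \sum_(Q <- s) (c Q - lam)%:E * a Q.
Proof.
move=> + + a0; elim: s lam => [|Q s IH] lam l0 /=; first by rewrite big_nil.
move=> /andP[lQ Qs]; have Q0 : (0 <= c Q)%R by exact: le_trans lQ.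
rewrite IH// !powRr1// !big_cons ge0_muleDr//; last exact: sume_ge0.
rewrite -addeA; congr (_ + _).
rewrite ge0_sume_distrr// -big_split/=; apply: eq_big_seq => P Ps.
by rewrite -ge0_muleDl ?lee_fin ?subr_ge0 ?(increasing_from_ge Qs)// -EFinD addrC subrKA.
Qed.

Section Integral.
Variable nu : {measure set X -> \bar R}.

Lemma measurable_layer_sum p lam s : {in s, forall Q, measurable Q} ->
  measurable_fun setT (fun x => layer_sum p lam s (fun t => (\1_(cover t) x)%:E)).
Proof.
elim: s lam => [|Q s IH] lam ms /=; first exact: measurable_cst.
apply: emeasurable_funD.
  apply: measurable_funeM; apply/measurable_EFinP/measurable_indic.
  exact: measurable_cover.
by apply: IH => P Ps; apply: ms; rewrite inE Ps orbT.
Qed.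

Lemma integral_layer_sum p lam s : (0 < p)%R -> (0 <= lam)%R ->
  increasing_from lam s -> {in s, forall Q, measurable Q} ->
  \int[nu]_x layer_sum p lam s (fun t => (\1_(cover t) x)%:E) =
  layer_sum p lam s (fun t => nu (cover t)).
Proof.
move=> p0; elim: s lam => [|Q s IH] lam l0 /=; first by rewrite integral0.
move=> /andP[lQ Qs] ms; have Q0 : (0 <= c Q)%R by exact: le_trans lQ.
have ms' : {in s, forall Q, measurable Q}.
  by move=> P Ps; apply: ms; rewrite inE Ps orbT.
have ind0 t x : 0 <= (\1_(cover t) x : R)%:E by rewrite lee_fin.
have mind : measurable_fun setT (fun x => (\1_(cover (Q :: s)) x : R)%:E).
  by apply/measurable_EFinP/measurable_indic; exact: measurable_cover.
rewrite ge0_integralD//.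
- rewrite IH// ge0_integralZl_EFin ?powR_incr// integral_indic ?setIT//.
  exact: measurable_cover.
- by move=> x _; rewrite mule_ge0// lee_fin powR_incr.
- exact: measurable_funeM.
- by move=> x _; exact: layer_sum_ge0.
- exact: measurable_layer_sum.
Qed.

Lemma integral_max_on p s : (0 < p)%R ->
  increasing_from 0 s -> {in s, forall Q, measurable Q} ->
  \int[nu]_x (max_on c s x `^ p)%:E = layer_sum p 0 s (fun t => nu (cover t)).
Proof.
move=> p0 s0 ms; rewrite -integral_layer_sum//; apply: eq_integral => x _.
rewrite layer_sum_indic// powR0 ?gt_eqF// subr0 indicE.
have [|xs] := boolP (x \in cover s); first by rewrite mulr1.
rewrite max_on_notin ?powR0 ?gt_eqF ?mul0r//.
by move/mem_set; apply/negP.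
Qed.

End Integral.

(** Reduces an inequality between layer sums to one estimate per superlevel set: [Q :: t] stands for
    a tail of the sorted list and [b] for the preceding level. *)
Lemma le_layer_sum p q k lam s V W : (0 < q)%R -> (0 <= k)%R -> (0 <= lam)%R ->
  increasing_from lam s -> uniq s -> (forall t, 0 <= W t) ->
  (forall Q t b, uniq (Q :: t) -> {subset Q :: t <= s} ->
    {in Q :: t, forall P, (c Q <= c P)%R} -> (0 <= b)%R -> (b <= c Q)%R ->
    (c Q `^ p - b `^ p)%:E * V (Q :: t) <=
    k%:E * ((c Q `^ q - b `^ q)%:E * W (Q :: t))) ->
  layer_sum p lam s V <= k%:E * layer_sum q lam s W.
Proof.
move=> q0 k0 + + + W0; elim: s lam => [|Q s IH] lam l0 /=; first by rewrite mule0.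
move=> /andP[lQ Qs] us H; have Q0 : (0 <= c Q)%R by exact: le_trans lQ.
rewrite ge0_muleDr; last 2 first.
- by rewrite mule_ge0// lee_fin powR_incr.
- exact: layer_sum_ge0.
apply: leeD.
  apply: H => // P; rewrite inE => /predU1P[->//|]; exact: increasing_from_ge.
apply: IH => //; first by case/andP: us.
by move=> P t b ut ts; apply: H => // P' /ts; rewrite inE => ->; rewrite orbT.
Qed.

End LayerCake.

(** * Carleson embedding and Doob's maximal inequality for finite nested families *)

Section MaximalInequalities.
Context d (X : measurableType d) (R : realType).
Local Open Scope ereal_scope.
Variables (nu : {measure set X -> \bar R}) (c : set X -> R) (s : seq (set X)).
Hypotheses (ns : nested s) (ms : {in s, forall Q, measurable Q}) (us : uniq s).
Hypothesis c0 : {in s, forall Q, 0 <= c Q}%R.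

Let leT (P Q : set X) := (c P <= c Q)%R.
Let s' := sort leT s.

Let mem_s' : s' =i s. Proof. exact: mem_sort. Qed.

Let us' : uniq s'. Proof. by rewrite sort_uniq. Qed.

Let s'_incr : increasing_from c 0 s'.
Proof.
rewrite /increasing_from (path_sortedE le_trans); apply/andP; split.
  by apply/allP => _ /mapP[Q + ->]; rewrite mem_s' => /c0.
rewrite sorted_map; apply: sort_sorted => P Q; exact: le_total.
Qed.

Let ms' : {in s', forall Q, measurable Q}.
Proof. by move=> Q; rewrite mem_s' => /ms. Qed.

(** With [s] sorted by [c], both sides are layer sums with exponent 1. On each tail the packing
    condition, applied to the maximal members, bounds the sum of [a] by the measure of the union. *)
Lemma carleson_embedding (a : set X -> \bar R) : (forall Q, 0 <= a Q) ->
  (forall Q t, Q \in s -> uniq t -> {subset t <= s} ->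
    {in t, forall P, P `<=` Q} -> \sum_(P <- t) a P <= nu Q) ->
  \sum_(Q <- s) (c Q)%:E * a Q <= \int[nu]_x (max_on c s x)%:E.
Proof.
move=> a0 carl.
under eq_integral do rewrite -(eq_max_on c _ mem_s') -[max_on _ _ _]powRr1 ?max_on_ge0//.
rewrite integral_max_on// -(perm_big _ (permEl (perm_sort leT s))) -/s'.
rewrite (eq_bigr (fun Q => (c Q - 0)%:E * a Q)); last by move=> Q _; rewrite subr0.
rewrite -layer_sum_sum// -[leRHS]mul1e.
apply: le_layer_sum => // Q t b ut ts cQ b0 bQ.
rewrite mul1e lee_wpmul2l ?lee_fin ?subr_ge0 ?powRr1 ?(le_trans b0)//.
have ts0 : {subset Q :: t <= s} by move=> P /ts; rewrite mem_s'.
apply: (nested_cover_le (V := fun t => \sum_(Q <- t) a Q)) => //.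
- by move=> P P' /ts0 Ps /ts0; exact: ns.
- by move=> P /ts0 /ms.
- by rewrite big_nil.
- by move=> P r _ _; rewrite [leLHS](bigID P)/= !big_filter.
- move=> P r Pt ur rt Pr; apply: carl => //; first exact: ts0.
  by move=> P' /rt /ts0.
Qed.

Variables (f : X -> \bar R) (p : R).
Hypotheses (hf : nonneg_measurable f) (p1 : (1 < p)%R).
Hypothesis cf :
  {in s, forall Q, nu Q < +oo /\ (c Q)%:E * nu Q <= \int[nu]_(x in Q) f x}.

(** Makes the integral of the p-th power of the maximal function finite, so that it can be absorbed
    in Doob's inequality. *)
Let nu_cover_fin t : {subset t <= s} -> nu (cover t) \is a fin_num.
Proof.
elim: t => [|Q t IH] ts.
  by rewrite /cover set_nil bigcup_set0 measure0.
have Qs : Q \in s by apply: ts; exact: mem_head.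
have ts' : {subset t <= s} by move=> P Pt; apply: ts; rewrite inE Pt orbT.
rewrite cover_cons ge0_fin_numE//; apply: le_lt_trans (measureU2 _ _ _) _.
- exact: ms.
- by apply: measurable_cover => P /ts' /ms.
- by apply: lte_add_pinfty; [exact: (cf Qs).1|rewrite -ge0_fin_numE// IH].
Qed.

(** The weak-type estimate: the superlevel set is the disjoint union of its maximal members [P], and
    [c Q * nu P <= c P * nu P], which is at most the integral of [f] over [P]. *)
Let level_bound Q t : uniq (Q :: t) -> {subset Q :: t <= s} ->
  {in Q :: t, forall P, c Q <= c P}%R ->
  (c Q)%:E * nu (cover (Q :: t)) <= wmeasure nu hf (cover (Q :: t)).
Proof.
move=> ut ts cQ; have Q0 : (0 <= c Q)%R by apply/c0/ts; exact: mem_head.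
have mt P : P \in Q :: t -> measurable P by move=> /ts /ms.
apply: (nested_cover_le (V := fun t => (c Q)%:E * nu (cover t))) => //.
- by move=> P P' /ts Ps /ts; exact: ns.
- by rewrite /cover set_nil bigcup_set0 measure0 mule0.
- move=> P r _ rt.
  have mr B : measurable (cover (seq.filter B r)).
    by apply: measurable_cover => P'; rewrite mem_filter => /andP[_ /rt /mt].
  rewrite (cover_filter P) -ge0_muleDr// lee_wpmul2l ?lee_fin//.
  exact: measureU2.
- move=> P r Pt _ rt rP; have Ps := ts _ Pt.
  apply: le_trans (cf Ps).2.
  apply: lee_pmul; rewrite ?lee_fin ?cQ// le_measure ?inE//.
  + by apply: measurable_cover => P' /rt /mt.
  + exact: mt.
  + by move=> x [P' /= /rP]; apply.
Qed.

(** Write [M] for the maximal function, [p'] for [conj_exp p] and [I] for the left-hand side. The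
    weak-type estimate, summed over levels, gives [I <= p' * int M^(p-1) f]; Young's inequality
    bounds this by a multiple of [int f^p] plus [I/p'], which is absorbed. *)
Lemma doob_maximal_inequality :
  \int[nu]_x (max_on c s x `^ p)%:E <=
  (conj_exp p `^ p)%:E * \int[nu]_x f x `^ p.
Proof.
have p0 : (0 < p)%R by apply: lt_trans p1.
have pm0 : (0 < p - 1)%R by rewrite subr_gt0.
have q0 : (0 < conj_exp p)%R by rewrite divr_gt0.
have mM r : measurable_fun setT (fun x => (max_on c s x `^ r)%:E).
  apply/measurable_EFinP.
  exact: (measurableT_comp (measurable_powR r) (measurable_max_on c ms)).
have mfp : measurable_fun setT (fun x => f x `^ p).
  exact: (measurableT_comp (measurable_poweR p) hf.1).
have M0 r x : 0 <= (max_on c s x `^ r)%:E by rewrite lee_fin powR_ge0.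
pose I := \int[nu]_x (max_on c s x `^ p)%:E.
have IE r (m : {measure set X -> \bar R}) : (0 < r)%R ->
    \int[m]_x (max_on c s x `^ r)%:E = layer_sum c r 0 s' (fun t => m (cover t)).
  move=> r0; apply: etrans (integral_max_on m r0 s'_incr ms').
  apply: eq_integral => x _.
  by rewrite (eq_max_on c _ mem_s').
have I1 : I <= (conj_exp p)%:E * \int[nu]_x ((max_on c s x `^ (p - 1))%:E * f x).
  have -> : \int[nu]_x ((max_on c s x `^ (p - 1))%:E * f x) =
      \int[wmeasure nu hf]_x (max_on c s x `^ (p - 1))%:E.
    by rewrite (@ge0_integral_wmeasure _ _ _ nu f hf _ (conj (mM (p - 1)%R) (M0 (p - 1)%R))).
  rewrite /I !IE//.
  apply: le_layer_sum => //; first exact: ltW.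
  move=> Q t b ut ts cQ b0 bQ.
  have Q0 : (0 <= c Q)%R by exact: le_trans bQ.
  have ts0 : {subset Q :: t <= s} by move=> P /ts; rewrite mem_s'.
  have := level_bound ut ts0 cQ.
  have i0 : (0 <= c Q `^ (p - 1) - b `^ (p - 1))%R.
    by rewrite subr_ge0 ge0_ler_powR ?nnegrE ?(ltW pm0).
  move=> /(lee_wpmul2l (x := (conj_exp p * (c Q `^ (p - 1) - b `^ (p - 1)))%:E)).
  rewrite lee_fin mulr_ge0// ?(ltW q0)// => /(_ isT).
  rewrite [in leRHS]EFinM -muleA; apply: le_trans.
  rewrite muleA -EFinM lee_wpmul2r//.
  rewrite lee_fin (le_trans (powR_increment p1 b0 Q0))//.
  by rewrite [(c Q * _)%R]mulrC mulrA.
have Ifin : I \is a fin_num.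
  rewrite /I IE//; apply: layer_sum_fin_num => t ts; apply: nu_cover_fin => P /ts.
  by rewrite mem_s'.
(* Young's inequality is applied to [p' f] and [M], so that [M^p] receives the coefficient
   [(p-1)/p = 1/p' < 1]. *)
have {I1} : I <= (conj_exp p `^ p / p)%:E * \int[nu]_x f x `^ p +
                 (conj_exp p)^-1%:E * I.
  apply: le_trans I1 _.
  have cq0 : (0 <= conj_exp p `^ p / p)%R by rewrite divr_ge0 ?powR_ge0 ?ltW.
  have ciq0 : (0 <= (conj_exp p)^-1)%R by rewrite invr_ge0 ltW.
  rewrite -!ge0_integralZl_EFin//; last 4 first.
  - by move=> x _; exact: poweR_ge0.
  - by move=> x _; rewrite mule_ge0//; exact: hf.2.
  - by apply: emeasurable_funM => //; exact: hf.1.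
  - exact: ltW.
  rewrite -ge0_integralD//; last 4 first.
  - by move=> x _; rewrite mule_ge0// ?lee_fin// poweR_ge0.
  - exact: measurable_funeM.
  - by move=> x _; rewrite mule_ge0// lee_fin.
  - exact: measurable_funeM.
  apply: le_ge0_integral => x _.
    by rewrite !mule_ge0// ?lee_fin ?(ltW q0)//; exact: hf.2.
  have := hf.2 x; case: (f x) => [y|_|//]; last first.
    rewrite poweRyr ?gt_eqF//.
    rewrite (@gt0_muley _ (conj_exp p `^ p / p)%:E) ?lte_fin ?divr_gt0 ?powR_gt0//.
    by rewrite addye ?leey// gt_eqF// (lt_le_trans ltNy0)// mule_ge0// lee_fin.
  rewrite lee_fin => y0; rewrite poweR_EFin -!EFinM -EFinD lee_fin.
  have := young_powR p1 (mulr_ge0 (ltW q0) y0) (max_on_ge0 c s x).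
  rewrite powRM ?(ltW q0)//.
  set A := (conj_exp p `^ p)%R; set B := (y `^ p)%R.
  set M := (max_on c s x `^ p)%R; set M' := (max_on c s x `^ (p - 1))%R.
  have E1 : (conj_exp p * (M' * y) = p^-1 * (p * (conj_exp p * y * M')))%R.
    by field; rewrite gt_eqF.
  have E2 : (p^-1 * (A * B + (p - 1) * M) = A / p * B + (conj_exp p)^-1 * M)%R.
    by rewrite /conj_exp; field; rewrite !gt_eqF.
  by move=> Y; rewrite E1 -E2 ler_wpM2l// invr_ge0 ltW.
have F0 : 0 <= \int[nu]_x f x `^ p by apply: integral_ge0 => x _; exact: poweR_ge0.
rewrite -/I; move: Ifin F0; case: I => // i _.
case: (\int[nu]_x _) => [F|_|//]; last first.
  have A0 : 0 < (conj_exp p `^ p)%:E by rewrite lte_fin powR_gt0.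
  by rewrite (gt0_muley A0) leey.
rewrite -!EFinM -EFinD !lee_fin => F0.
set A := (conj_exp p `^ p)%R => H.
(* Since [I] is finite, [I - I/p' = I/p]. *)
suff : (i * p^-1 <= A * F * p^-1)%R by rewrite ler_pM2r// invr_gt0.
have -> : (i * p^-1 = i - (conj_exp p)^-1 * i)%R.
  by rewrite /conj_exp; field; rewrite !gt_eqF.
by rewrite lerBlDr (le_trans H)// lerD2r mulrAC.
Qed.

End MaximalInequalities.

(** * Hoelder inequalities and sums in the extended reals *)

Section ExtendedReals.
Context (R : realType).
Local Open Scope ereal_scope.

Lemma le_poweR2 (p : R) (x y : \bar R) : (0 <= p)%R -> 0 <= x -> x <= y ->
  x `^ p <= y `^ p.
Proof.
move=> p0 x0 xy; apply: gt0_ler_poweR; rewrite ?in_itv/= ?leey ?andbT//.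
exact: le_trans xy.
Qed.

Lemma poweR_prod I (r : seq I) (F : I -> \bar R) (p : R) : (forall i, 0 <= F i) ->
  (\prod_(i <- r) F i) `^ p = \prod_(i <- r) F i `^ p.
Proof.
move=> F0; elim: r => [|i r IH]; first by rewrite !big_nil poweR1r.
by rewrite !big_cons poweRM ?IH// prode_ge0.
Qed.

Lemma prode_eq0P n (F : 'I_n -> \bar R) :
  \prod_(i < n) F i = 0 <-> exists i, F i = 0.
Proof.
split; last by case=> i Fi; rewrite (bigD1 i)//= Fi mul0e.
elim/big_ind : _ => [/eqP|x y IHx IHy /eqP|i _ Fi]; last by exists i.
  by rewrite onee_eq0.
by rewrite mule_eq0 => /orP[/eqP/IHx|/eqP/IHy].
Qed.

(** As [p - 1 <= 0], any [z] with [0 < z <= x + y] satisfies [z (x+y)^(p-1) <= z^p]; add the cases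
    [z = x] and [z = y]. *)
Lemma poweRD_le (p : R) (x y : \bar R) : (0 < p)%R -> (p <= 1)%R ->
  0 <= x -> 0 <= y -> (x + y) `^ p <= x `^ p + y `^ p.
Proof.
move=> p0 p1; case: x => [x|_ _|//]; last first.
  rewrite [+oo `^ p]poweRyr ?gt_eqF// [leRHS]addye ?leey//.
  by rewrite gt_eqF// (lt_le_trans ltNy0)// poweR_ge0.
rewrite lee_fin => x0; case: y => [y|_|//]; last first.
  by rewrite [+oo `^ p]poweRyr ?gt_eqF// [leRHS]addey// leey.
rewrite lee_fin => y0; rewrite -EFinD !poweR_EFin -EFinD lee_fin.
have [->|xN0] := eqVneq x 0%R; first by rewrite powR0 ?gt_eqF// !add0r.
have [->|yN0] := eqVneq y 0%R; first by rewrite powR0 ?gt_eqF// !addr0.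
have {xN0}x0 : (0 < x)%R by rewrite lt0r xN0.
have {yN0}y0 : (0 < y)%R by rewrite lt0r yN0.
have s0 : (0 < x + y)%R by rewrite addr_gt0.
have H z : (0 < z)%R -> (z <= x + y)%R -> (z * (x + y) `^ (p - 1) <= z `^ p)%R.
  move=> z0 zs; have -> : (z `^ p = z * z `^ (p - 1))%R.
    rewrite -{2}(powRr1 (ltW z0)) -powRD ?subrKC//.
    by rewrite gt_eqF// implybT.
  rewrite ler_wpM2l ?(ltW z0)//.
  have -> : (p - 1 = - (1 - p))%R by rewrite opprB.
  rewrite !powRN lef_pV2 ?posrE ?powR_gt0//.
  by rewrite ge0_ler_powR ?nnegrE ?subr_ge0// ltW.
have -> : ((x + y) `^ p = x * (x + y) `^ (p - 1) + y * (x + y) `^ (p - 1))%R.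
  rewrite -mulrDl -{2}(powRr1 (ltW s0)) -powRD ?subrKC//.
  by rewrite gt_eqF// implybT.
by rewrite lerD// H// ?lerDl ?lerDr ltW.
Qed.

Lemma esum_poweR_le (T : choiceType) (D : set T) (a : T -> \bar R) (p : R) :
  (0 < p)%R -> (p <= 1)%R -> (forall i, 0 <= a i) ->
  (\esum_(i in D) a i) `^ p <= \esum_(i in D) a i `^ p.
Proof.
move=> p0 p1 a0; set U := \esum_(i in D) a i `^ p.
have U0 : 0 <= U by apply: esum_ge0 => i _; exact: poweR_ge0.
(* Taking p-th roots leaves a bare supremum on the left, which can be bounded on each finite subset
   separately. *)
suff H : \esum_(i in D) a i <= U `^ p^-1.
  rewrite -[leRHS]poweRe1// -(mulVf (x := p)) ?gt_eqF// poweRrM.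
  by apply: le_poweR2 => //; [exact: ltW|exact: esum_ge0].
apply: ge_ereal_sup => _ [A [finA AD] <-].
have -> : \sum_(i \in A) a i = (\sum_(i \in A) a i) `^ (p * p^-1).
  rewrite divff ?gt_eqF// poweRe1//.
  by rewrite fsbig_finite//; exact: sume_ge0.
rewrite poweRrM; apply: le_poweR2; [by rewrite invr_ge0 ltW|exact: poweR_ge0|].
apply: le_trans (_ : \sum_(i \in A) a i `^ p <= _); last first.
  by apply: ereal_sup_ubound; exists A.
rewrite !fsbig_finite//; elim: (finmap.enum_fset _) => [|i r IH].
  by rewrite !big_nil poweR0r// gt_eqF.
rewrite !big_cons; apply: le_trans (poweRD_le p0 p1 _ _) _ => //.
  by apply: sume_ge0.
by rewrite leeD2l.
Qed.

(** An enumeration of the countable set [D] turns the sum into a series of non-negative functions,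
    which may be integrated termwise. *)
Lemma ge0_integral_esum d (X : measurableType d) (nu : {measure set X -> \bar R})
    (T : pointedType) (D : set T) (F : T -> X -> \bar R) :
  countable D -> (forall i x, 0 <= F i x) ->
  (forall i, D i -> measurable_fun setT (F i)) ->
  \int[nu]_x (\esum_(i in D) F i x) = \esum_(i in D) (\int[nu]_x F i x).
Proof.
move=> /countable_bijP[B]; rewrite card_eq_sym => /card_set_bijP[e eBD] F0 mF.
have H (G : T -> \bar R) : (forall i, 0 <= G i) ->
    \esum_(i in D) G i = \sum_(0 <= k <oo) (if k \in B then G (e k) else 0).
  move=> G0; rewrite (reindex_esum B D e)// esum_mkcond nneseries_esumT// => k.
  by case: ifP.
under eq_integral do rewrite H//.
rewrite H; last by move=> i; exact: integral_ge0.
rewrite integral_nneseries//.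
- apply: eq_eseriesr => k _; case: (k \in B) => //.
  by rewrite integral0.
- move=> k; have [|_] := boolP (k \in B); last exact: measurable_cst.
  by rewrite inE => Bk; apply: mF; case: eBD => + _ _; apply.
- by move=> k x _; case: (k \in B).
Qed.

End ExtendedReals.

(** * Hoelder's inequality with several factors, and Doob's inequality for averages *)

Section Hoelder.
Context d (X : measurableType d) (R : realType).
Variable nu : {measure set X -> \bar R}.
Local Open Scope ereal_scope.

(** Hoelder's inequality with exponents [1/theta_i]: apply the weighted AM-GM inequality to
    [h_i / A_i] and integrate; the result is at most [sum theta_i = 1]. *)
Lemma ge0_integral_prod_poweR_le n (theta A : 'I_n -> R) (h : 'I_n -> X -> \bar R)
    (B : set X) : measurable B ->
  (forall i, 0 < theta i)%R -> (\sum_(i < n) theta i = 1)%R ->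
  (forall i, 0 < A i)%R -> (forall i, nonneg_measurable (h i)) ->
  (forall i, \int[nu]_(x in B) h i x <= (A i)%:E) ->
  \int[nu]_(x in B) \prod_(i < n) h i x `^ theta i <=
  (\prod_(i < n) A i `^ theta i)%:E.
Proof.
move=> mB theta0 theta1 A0 hh hA; set K := (\prod_(i < n) _)%R.
have K0 : (0 < K)%R by apply: prodr_gt0 => i _; exact: powR_gt0.
have iA0 i : (0 <= theta i / A i)%R by rewrite divr_ge0// ltW.
have mh i : measurable_fun B (h i) by apply: measurable_funTS; exact: (hh i).1.
have h0 i x : 0 <= h i x by exact: (hh i).2.
have msum : measurable_fun B (fun x => \sum_(i < n) (theta i / A i)%:E * h i x).
  by apply: emeasurable_sum => i; exact: measurable_funeM.
apply: (@le_trans _ _ (\int[nu]_(x in B) (K%:E * \sum_(i < n) (theta i / A i)%:E * h i x))).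
  apply: le_ge0_integral => x _; first by apply: prode_ge0 => i _; exact: poweR_ge0.
  rewrite (eq_bigr (fun i => (A i `^ theta i)%:E * ((A i)^-1%:E * h i x) `^ theta i)); last first.
    move=> i _; rewrite -poweR_EFin -poweRM; last 2 first.
    - by rewrite lee_fin ltW.
    - by rewrite mule_ge0// lee_fin invr_ge0 ltW.
    by rewrite muleA -EFinM divff ?gt_eqF// mul1e.
  rewrite big_split/= prodEFin lee_wpmul2l ?lee_fin ?(ltW K0)//.
  apply: le_trans (ge0_weighted_amgm theta0 theta1 _) _ => [i|].
    by rewrite mule_ge0// lee_fin invr_ge0 ltW.
  by apply: lee_sum => i _; rewrite muleA -EFinM.
rewrite ge0_integralZl_EFin//; last 2 first.
- by move=> x _; apply: sume_ge0 => i _; rewrite mule_ge0// lee_fin.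
- exact: ltW.
rewrite -[leRHS]mule1 lee_wpmul2l ?lee_fin ?(ltW K0)//.
rewrite ge0_integral_sum//; last 2 first.
- by move=> i; exact: measurable_funeM.
- by move=> i x _; rewrite mule_ge0// lee_fin.
rewrite -theta1 -sumEFin; apply: lee_sum => i _.
rewrite ge0_integralZl_EFin//.
have -> : (theta i)%:E = (theta i / A i)%:E * (A i)%:E.
  by rewrite -EFinM divfK ?gt_eqF.
by rewrite lee_wpmul2l// lee_fin.
Qed.

(** The last bound is Hoelder's inequality for the integral of [f] over [Q], up to the factor
    [conj_exp p]. It is read off from the maximal bound, as the maximal function is at least [c Q]
    on [Q]. *)
Lemma doob_average (f : X -> \bar R) (s : seq (set X)) (p N : R) :
  let c Q := (fine (\int[nu]_(x in Q) f x) / fine (nu Q))%R in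
  nested s -> {in s, forall Q, measurable Q} -> uniq s ->
  nonneg_measurable f -> (1 < p)%R ->
  {in s, forall Q, 0 < nu Q < +oo} -> 'N[nu]_(p%:E)[f] = N%:E ->
  [/\ {in s, forall Q, \int[nu]_(x in Q) f x \is a fin_num},
      \int[nu]_x (max_on c s x `^ p)%:E <= ((conj_exp p * N) `^ p)%:E &
      {in s, forall Q, c Q `^ p * fine (nu Q) <= (conj_exp p * N) `^ p}%R].
Proof.
move=> c ns ms us [mf f0] p1 nus fN.
have p0 : (0 < p)%R by apply: lt_trans p1.
have N0 : (0 <= N)%R by rewrite -lee_fin -fN Lnorm_ge0.
have fp : \int[nu]_x (f x `^ p) = (N `^ p)%:E.
  rewrite -poweR_EFin -fN poweR_Lnorm ?gt_eqF//.
  by apply: eq_integral => x _; rewrite gee0_abs.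
have mfp : measurable_fun setT (fun x => f x `^ p).
  exact: (measurableT_comp (measurable_poweR p) mf).
have q0 : (0 < conj_exp p)%R by rewrite divr_gt0// subr_gt0.
have nuE Q : Q \in s -> nu Q = (fine (nu Q))%:E.
  by move=> /nus /andP[_ Qoo]; rewrite fineK// ge0_fin_numE.
have If Q : Q \in s -> \int[nu]_(x in Q) f x \is a fin_num.
  move=> Qs; rewrite ge0_fin_numE; last by apply: integral_ge0 => x _.
  (* Integrability on [Q] comes from [f <= 1 + f^p] and the finiteness of [nu Q]. *)
  apply: (@le_lt_trans _ _ (\int[nu]_(x in Q) (1 + f x `^ p))).
    apply: le_ge0_integral => x _ //.
    have := f0 x; case: (f x) => [y|_|//]; last first.
      by rewrite poweRyr ?gt_eqF// addey// leey.
    rewrite lee_fin poweR_EFin -EFinD lee_fin => y0.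
    have [y1|y1] := leP y 1%R; first by rewrite (le_trans y1)// lerDl powR_ge0.
    by rewrite (le_trans (le1r_powR (ltW y1) (ltW p1)))// lerDr.
  rewrite ge0_integralD//; last 3 first.
  - exact: ms.
  - by move=> x _; exact: poweR_ge0.
  - exact: measurable_funTS.
  rewrite integral_cst ?mul1e; [|exact: ms].
  have /andP[_ Qoo] := nus _ Qs; apply: lte_add_pinfty => //.
  apply: (@le_lt_trans _ _ (N `^ p)%:E); last exact: ltry.
  rewrite -fp; apply: ge0_subset_integral => //; first exact: ms.
  by move=> x _; exact: poweR_ge0.
have c0 : {in s, forall Q, 0 <= c Q}%R.
  move=> Q Qs; rewrite divr_ge0// fine_ge0//.
  by apply: integral_ge0 => x _.
have D : \int[nu]_x (max_on c s x `^ p)%:E <= ((conj_exp p * N) `^ p)%:E.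
  rewrite powRM ?(ltW q0)// EFinM -fp; apply: doob_maximal_inequality => //.
  move=> Q Qs; have /andP[Q0 Qoo] := nus _ Qs; split => //.
  rewrite nuE// -EFinM divfK ?fineK ?If//.
  by rewrite gt_eqF// fine_gt0// Q0.
split => // Q Qs; rewrite -lee_fin; apply: le_trans D.
rewrite EFinM -nuE// -integral_cst; last exact: ms.
rewrite integral_mkcond; apply: le_ge0_integral => x _.
  by apply: erestrict_ge0 => y _; rewrite lee_fin powR_ge0.
rewrite patchE; case: ifPn => [|_]; last by rewrite lee_fin powR_ge0.
rewrite inE => Qx; rewrite lee_fin ge0_ler_powR ?nnegrE ?c0 ?(ltW p0) ?max_on_ge0//.
exact: le_max_on.
Qed.

End Hoelder.

(** * The Muckenhoupt and Fujii-Wilson characteristics *)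

Section TestingInequality.
Context (R : realType).

(** For [I > 0] take logarithms. The powers of [m] cancel because [1/t + 1/t' = 1], and the
    difference of the two sides is [rho * r / alpha] times the slack in the logarithm of the last
    hypothesis. *)
Lemma testing_factor (r rho t alpha m W I N : R) :
  let theta := r * (1 / t - rho) / alpha in
  0 < r -> 0 <= rho -> 1 < t -> 0 < alpha ->
  0 < m -> 0 < W -> 0 <= I -> 0 < N -> (I / W) `^ t * W <= N `^ t ->
  (m `^ (- (1 - rho)) * I) `^ (r / alpha) * m `^ theta *
    (W / m) `^ (- (r / conj_exp t / alpha)) <=
  N `^ (rho * t * r / alpha) * (W `^ theta * (I / W) `^ (t * theta)).
Proof.
move=> theta r0 rho0 t1 a0 m0 W0 + N0.
have t0 : 0 < t by apply: lt_trans t1.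
rewrite le_eqVlt => /predU1P[<- _|I0].
  rewrite mulr0 powR0; last by rewrite mulf_neq0 ?invr_neq0 ?gt_eqF.
  by rewrite !mul0r !mulr_ge0 ?powR_ge0.
rewrite -ler_ln ?posrE ?mulr_gt0 ?powR_gt0 ?divr_gt0//.
rewrite lnM ?posrE ?powR_gt0 ?divr_gt0// !ln_powR ln_div ?posrE// => H.
rewrite -ler_ln ?posrE ?mulr_gt0 ?powR_gt0 ?mulr_gt0 ?powR_gt0 ?divr_gt0//.
rewrite !(ln_div, lnM, ln_powR) ?posrE ?mulr_gt0 ?powR_gt0 ?mulr_gt0 ?powR_gt0
  ?divr_gt0 ?invr_gt0//.
set lN := ln N in H *; set lI := ln I in H *; set lW := ln W in H *; set lm := ln m.
rewrite -subr_ge0.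
set E := (X in 0 <= X).
have -> : E = rho * r / alpha * (t * lN - (t * (lI - lW) + lW)).
  by rewrite /E /theta /conj_exp; field; rewrite !gt_eqF// subr_gt0.
by rewrite mulr_ge0 ?subr_ge0// divr_ge0 ?mulr_ge0// ltW.
all: by rewrite invr_gt0.
Qed.

Lemma powR_prod I (s : seq I) (F : I -> R) (p : R) : (forall i, 0 <= F i) ->
  (\prod_(i <- s) F i) `^ p = \prod_(i <- s) F i `^ p.
Proof.
move=> F0; elim: s => [|i s IH]; first by rewrite !big_nil powR1.
by rewrite !big_cons powRM ?IH// prodr_ge0.
Qed.

Lemma prod_powR_sum I (s : seq I) (theta : I -> R) (m : R) : 0 < m ->
  \prod_(i <- s) m `^ theta i = m `^ (\sum_(i <- s) theta i).
Proof.
move=> m0; under eq_bigr do rewrite /powR gt_eqF//.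
by rewrite -expR_sum -mulr_suml /powR gt_eqF.
Qed.

(** Here [m], [W i], [Wm] and [I i] stand for [mu Q], the weights of [Q] and the integrals of
    [f_i w_i]. The Muckenhoupt bound is solved for [Wm]; writing [m] as the product of the
    [m^theta_i] then splits the claim into one factor per index. *)
Lemma testing_bound n (r rho t : 'I_n -> R) (m Wm Mk : R) (W I N : 'I_n -> R) :
  let beta := fun i => r i * (1 / t i - rho i) in
  let alpha := \sum_(i < n) beta i in
  (forall i, 0 < r i) -> (forall i, 0 <= rho i) -> (forall i, 1 < t i) ->
  0 < alpha -> 0 < m -> 0 <= Wm ->
  (forall i, 0 < W i) -> (forall i, 0 <= I i) -> (forall i, 0 < N i) ->
  (forall i, (I i / W i) `^ t i * W i <= N i `^ t i) ->
  \prod_(i < n) (W i / m) `^ (r i / conj_exp (t i)) * (Wm / m) `^ alpha <= Mk ->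
  \prod_(i < n) (m `^ (- (1 - rho i)) * I i) `^ (r i / alpha) * Wm <=
  Mk `^ (1 / alpha) * \prod_(i < n) N i `^ (rho i * t i * r i / alpha) *
  (\prod_(i < n) (I i / W i) `^ (t i * (beta i / alpha)) *
   \prod_(i < n) W i `^ (beta i / alpha)).
Proof.
move=> beta alpha r0 rho0 t1 a0 m0 Wm0 W0 I0 N0 IN Mkb.
pose V := \prod_(i < n) (W i / m) `^ (- (r i / conj_exp (t i) / alpha)).
have V0 : 0 < V by apply: prodr_gt0 => i _; rewrite powR_gt0 ?divr_gt0.
have WmE : Wm <= Mk `^ (1 / alpha) * (m * V).
  have p0 i : 0 <= (W i / m) `^ (r i / conj_exp (t i)) by rewrite powR_ge0.
  have L0 : 0 <= \prod_(i < n) (W i / m) `^ (r i / conj_exp (t i)) * (Wm / m) `^ alpha.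
    by rewrite mulr_ge0 ?powR_ge0// prodr_ge0.
  have := ge0_ler_powR (r := 1 / alpha) _ _ _ Mkb.
  rewrite !nnegrE divr_ge0 ?(ltW a0)// L0 (le_trans L0 Mkb) => /(_ isT isT isT).
  rewrite powRM ?powR_ge0 ?prodr_ge0// -powRrM mulrCA divff ?gt_eqF// mulr1.
  rewrite powRr1 ?divr_ge0 ?(ltW m0)// powR_prod// => H.
  have VE : \prod_(i < n) (W i / m) `^ (r i / conj_exp (t i)) `^ (1 / alpha) = V^-1.
    rewrite /V -prodfV; apply: eq_bigr => i _.
    by rewrite -powRrM powRN invrK mul1r.
  move: H; rewrite VE mulrA ler_pdivrMr// mulrC.
  by rewrite -ler_pdivlMr ?invr_gt0// invrK -mulrA.
have theta1 : \sum_(i < n) beta i / alpha = 1 by rewrite -mulr_suml divff ?gt_eqF.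
have pre0 : 0 <= \prod_(i < n) (m `^ (- (1 - rho i)) * I i) `^ (r i / alpha).
  by apply: prodr_ge0 => i _; exact: powR_ge0.
apply: le_trans (ler_wpM2l pre0 WmE) _.
rewrite mulrCA -[leRHS]mulrA ler_wpM2l ?powR_ge0//.
have -> : m * V = \prod_(i < n) m `^ (beta i / alpha) * V.
  by rewrite prod_powR_sum// theta1 powRr1// ltW.
rewrite -!big_split/=.
apply: ler_prod => i _; rewrite !mulr_ge0 ?powR_ge0//=.
rewrite [_ * W i `^ _]mulrC [leLHS]mulrA.
exact: testing_factor.
Qed.

End TestingInequality.

Section Encodings.
Context (R : realType).
Local Open Scope ereal_scope.

Lemma big_ord_lift_max (T : Type) (idx : T) (op : Monoid.law idx) k
    (F : 'I_k.+1 -> T) :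
  \big[op/idx]_(i < k.+1) F i =
  op (\big[op/idx]_(i < k) F (lift ord_max i)) (F ord_max).
Proof.
rewrite big_ord_recr; congr (op _ _); apply: eq_bigr => i _; congr F.
by apply: val_inj; exact/esym/lift_max.
Qed.

Lemma snoc_lift (T : Type) k (v : 'I_k -> T) a i : snoc v a (lift ord_max i) = v i.
Proof. by rewrite /snoc liftK. Qed.

Lemma snoc_max (T : Type) k (v : 'I_k -> T) a : snoc v a ord_max = a.
Proof. by rewrite /snoc unlift_none. Qed.

Lemma le_nnsup (A : set (\bar R)) x : A x -> x <= nnsup A.
Proof. by move=> Ax; apply: ereal_sup_ubound; right. Qed.

Lemma nnsup_ge0 (A : set (\bar R)) : 0 <= nnsup A.
Proof. by apply: ereal_sup_ubound; left. Qed.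

(** The conventions are harmless here: for [b = 0] a finite quotient forces [a = 0], and for
    infinite [b] the right-hand side is infinite. *)
Lemma quotient_le (a b : \bar R) (phi : R) : (0 < phi)%R -> 0 <= a -> 0 <= b ->
  quotient a b <= phi%:E -> a <= phi%:E * b.
Proof.
move=> phi0 a0 b0; rewrite /quotient.
case: b b0 => [b|_|//]; last by rewrite gt0_muley ?leey.
rewrite lee_fin le_eqVlt andbF => /predU1P[<-|b0].
  rewrite inve0 mule0; have [->//|aN0] := eqVneq a 0.
  by rewrite gt0_muley// lt0e aN0.
by rewrite inver gt_eqF// lee_pdivrMr.
Qed.

End Encodings.

(** * Lower bounds for the Fujii-Wilson characteristic and the packing of sparse sets *)

Section Characteristics.
Context d (X : measurableType d) (R : realType).
Variables (mu : {measure set X -> \bar R}) (D : set (set X)).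
Hypothesis hD : dyadic_grid mu D.
Variables (n : nat) (beta : 'I_n -> R) (w : 'I_n.+1 -> X -> \bar R).
Hypothesis beta0 : forall i, (0 < beta i)%R.
Hypothesis hw : forall i, nonneg_measurable (w i).
Let alpha := (\sum_(i < n) beta i)%R.
Hypothesis alpha0 : (0 < alpha)%R.
Let theta i := (beta i / alpha)%R.
Local Open Scope ereal_scope.
Let W i Q := \int[mu]_(x in Q) w (lift ord_max i) x.

Let theta0 i : (0 < theta i)%R. Proof. by rewrite divr_gt0. Qed.

Let theta1 : (\sum_(i < n) theta i = 1)%R.
Proof. by rewrite /theta -mulr_suml divff// gt_eqF. Qed.

Lemma prod_weight_nonneg_measurable :
  nonneg_measurable (fun x => \prod_(i < n) w (lift ord_max i) x `^ theta i).
Proof.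
split; last by move=> x; apply: prode_ge0 => i _; exact: poweR_ge0.
elim: (index_enum _) => [|i s IH].
  by under eq_fun do rewrite big_nil; exact: measurable_cst.
under eq_fun do rewrite big_cons; apply: emeasurable_funM => //.
exact: (measurableT_comp (measurable_poweR _) (hw _).1).
Qed.

Let sumE : (\sum_(i < n.+1) snoc beta 0%R i = alpha)%R.
Proof.
rewrite big_ord_lift_max/= snoc_max addr0.
by apply: eq_bigr => i _; rewrite snoc_lift.
Qed.

Let num Q := \int[mu]_(x in Q) maximal_op mu D
  (fun i => snoc beta 0%R i / alpha)%R (fun i y => (\1_Q y)%:E * w i y) x.
Let den Q := \int[mu]_(x in Q) \prod_(i < n) w (lift ord_max i) x `^ theta i.

Let maximal_op_ge0 r (g : 'I_n.+1 -> X -> \bar R) x : 0 <= maximal_op mu D r g x.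
Proof. exact: nnsup_ge0. Qed.

Let num_ge0 Q : 0 <= num Q.
Proof. by apply: integral_ge0 => x _; exact: maximal_op_ge0. Qed.

Let den_ge0 Q : 0 <= den Q.
Proof.
by apply: integral_ge0 => x _; apply: prode_ge0 => i _; exact: poweR_ge0.
Qed.

Let fujii_wilson_ge Q : D Q ->
  quotient (num Q `^ alpha) (den Q `^ alpha) <=
  fujii_wilson mu D (snoc beta 0%R) w.
Proof.
move=> DQ; apply: le_nnsup; exists Q => //.
rewrite sumE; congr (quotient (_ `^ _) (_ `^ _)).
(* The exponent of the last weight is 0, so its factor is 1 even where the weight is 0 or
   infinite. *)
apply: eq_integral => x _; rewrite big_ord_lift_max/= snoc_max mul0r poweRe0 mule1.
by apply: eq_bigr => i _; rewrite snoc_lift.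
Qed.

Let maximal_op_ge Q P x : D P -> P `<=` Q -> P x ->
  \prod_(i < n) average mu P (w (lift ord_max i)) `^ theta i <=
  maximal_op mu D (fun i => snoc beta 0%R i / alpha)%R
    (fun i y => (\1_Q y)%:E * w i y) x.
Proof.
move=> DP PQ Px; apply: le_nnsup; exists P => //.
rewrite big_ord_lift_max/= snoc_max mul0r poweRe0 mule1.
apply: eq_bigr => i _; rewrite snoc_lift; congr ((_ * _) `^ _).
apply: eq_integral => y; rewrite inE => Py.
by rewrite indicE mem_set ?mul1e//; exact: PQ.
Qed.

Lemma grid_measureE Q : D Q -> mu Q = (fine (mu Q))%:E /\ (0 < fine (mu Q))%R.
Proof.
move=> DQ; have [_ _ /(_ _ DQ)[Q0 Qoo] _] := hD.
by rewrite fineK ?ge0_fin_numE// fine_gt0 ?Q0.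
Qed.

Lemma averageE Q i : D Q -> average mu Q (w i) =
  (fine (mu Q))^-1%:E * \int[mu]_(x in Q) w i x.
Proof. by move=> DQ; rewrite /average; have [-> Q0] := grid_measureE DQ; rewrite inver gt_eqF. Qed.

Lemma prod_weight_le Q : D Q -> (forall i, 0 < W i Q < +oo) ->
  den Q <= (\prod_(i < n) fine (W i Q) `^ theta i)%:E.
Proof.
move=> DQ W0; apply: ge0_integral_prod_poweR_le => //.
- by have [_ + _ _] := hD; exact.
- by move=> i; exact: fine_gt0.
- by move=> i; rewrite fineK// ge0_fin_numE; have /andP[/ltW] := W0 i.
Qed.

(** The numerator at [Q] is at least [v * mu Q > 0], so a zero quotient needs a finite numerator
    over an infinite denominator. But a finite numerator makes every [W i Q] finite, and then
    Hoelder's inequality makes the denominator finite. *)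
Lemma fujii_wilson_eq0 Q : D Q -> (forall i, W i Q != 0) ->
  fujii_wilson mu D (snoc beta 0%R) w <> 0.
Proof.
move=> DQ WN0 FW0; have [mQE mQ0] := grid_measureE DQ.
have W0 i : 0 < W i Q.
  by rewrite lt0e WN0/=; apply: integral_ge0 => x _; exact: (hw _).2.
have mQ : measurable Q by have [_ + _ _] := hD; exact.
pose v := \prod_(i < n) average mu Q (w (lift ord_max i)) `^ theta i.
have av0 i : 0 < average mu Q (w (lift ord_max i)) `^ theta i.
  apply: poweR_gt0; rewrite averageE//.
  by apply: mule_gt0; [rewrite lte_fin invr_gt0|exact: W0].
have v0 : 0 < v.
  rewrite lt0e prode_ge0 ?andbT; last by move=> i _; exact: ltW.
  by apply/eqP => /prode_eq0P[i /eqP]; rewrite gt_eqF.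
have vnum : v * mu Q <= num Q.
  rewrite -integral_cst//; apply: le_ge0_integral => x Qx; first exact: ltW.
  exact: maximal_op_ge.
have num0 : 0 < num Q by apply: lt_le_trans vnum; rewrite mQE mule_gt0.
have := fujii_wilson_ge DQ; rewrite FW0 /quotient.
case: ifPn => [_|nd]; first by rewrite lee_fin ler10.
have [dy|dfin] := eqVneq (den Q `^ alpha) +oo; last first.
  rewrite leNgt mule_gt0 ?poweR_gt0// lt0e inve_eq0 dfin/=.
  by rewrite inve_ge0 poweR_ge0.
move: nd; rewrite dy eqxx andbT => numfin _.
have voo : v < +oo.
  rewrite ltey; apply/eqP => vy; move/negP: numfin; apply.
  have : num Q = +oo.
    by apply/eqP; rewrite -leye_eq (le_trans _ vnum)// vy mQE gt0_mulye ?lte_fin.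
  by move=> ->; rewrite poweRyr// gt_eqF.
have Woo i : W i Q < +oo.
  rewrite ltey; apply/eqP => Wy; move: voo; rewrite /v (bigD1 i)//= averageE//.
  rewrite -/(W i Q) Wy gt0_muley ?lte_fin ?invr_gt0// poweRyr ?gt_eqF//.
  rewrite gt0_mulye// lt0e prode_ge0 ?andbT; last by move=> j _; exact: ltW.
  elim/big_ind : _ => [//|x y x0 y0|j _]; first by rewrite mule_neq0.
  by rewrite gt_eqF ?av0.
have := prod_weight_le DQ (fun i => introT andP (conj (W0 i) (Woo i))).
by rewrite (poweR_eqy dy).
Qed.

(* The maximal function is at least [\prod_i (w_i)_P^theta_i] on the disjoint
   large subsets [E P] of the sparse sets [P], which makes the left-hand sides
   a Carleson sequence for the measure [\prod_i w_i^theta_i dmu]. *)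
Lemma sparse_carleson (eta phi : R) (S : set (set X)) (s : seq (set X)) Q :
  (0 < eta)%R -> (0 < phi)%R -> S `<=` D -> sparse mu eta S ->
  fujii_wilson mu D (snoc beta 0%R) w = phi%:E ->
  D Q -> uniq s -> {in s, forall P, [/\ S P, P `<=` Q & forall i, 0 < W i P < +oo]} ->
  \sum_(P <- s) (\prod_(i < n) fine (W i P) `^ theta i)%:E <=
  (eta^-1 * phi `^ (1 / alpha))%:E *
  wmeasure mu prod_weight_nonneg_measurable Q.
Proof.
move=> eta0 phi0 SD [E [mE EQ Eeta triE]] FW DQ us sS.
have mD P : D P -> measurable P by have [_ + _ _] := hD; exact.
have DP P : P \in s -> D P by case/sS => /SD.
pose v P := (\prod_(i < n) (fine (W i P) / fine (mu P)) `^ theta i)%R.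
have v0 P : (0 <= v P)%R by apply: prodr_ge0 => i _; exact: powR_ge0.
have vE P : P \in s -> (v P)%:E =
    \prod_(i < n) average mu P (w (lift ord_max i)) `^ theta i.
  move=> Ps; rewrite -prodEFin; apply: eq_bigr => i _.
  rewrite averageE; last exact: DP.
  rewrite -poweR_EFin mulrC EFinM fineK//.
  by have [_ _ /(_ i)/andP[W0 Woo]] := sS _ Ps; rewrite ge0_fin_numE// ltW.
have numden : num Q <= (phi `^ (1 / alpha))%:E * den Q.
  have := fujii_wilson_ge DQ; rewrite FW.
  move=> /(quotient_le phi0 (poweR_ge0 _ _) (poweR_ge0 _ _)).
  move=> /(le_poweR2 (p := 1 / alpha)).
  rewrite divr_ge0 ?(ltW alpha0)// poweR_ge0 => /(_ isT isT).
  rewrite poweRM ?lee_fin ?(ltW phi0) ?poweR_ge0// poweR_EFin -!poweRrM.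
  by rewrite mulrCA divff ?gt_eqF// mulr1 !poweRe1.
(* As the [theta_i] sum to 1, the product equals [v P * mu P], and sparseness replaces [mu P] by
   [mu (E P)] at the cost of [1/eta]. *)
have step P : P \in s -> (\prod_(i < n) fine (W i P) `^ theta i)%:E <=
    eta^-1%:E * ((v P)%:E * mu (E P)).
  move=> Ps; have [SP PQ W0] := sS _ Ps; have [muPE muP0] := grid_measureE (DP _ Ps).
  have -> : (\prod_(i < n) fine (W i P) `^ theta i)%:E = (v P)%:E * mu P.
    rewrite muPE -EFinM; congr EFin.
    have -> : (v P * fine (mu P) = v P * \prod_(i < n) fine (mu P) `^ theta i)%R.
      by rewrite prod_powR_sum// theta1 powRr1// ltW.
    rewrite -big_split/=; apply: eq_bigr => i _.
    rewrite -powRM ?divr_ge0 ?(ltW muP0)// ?divfK ?gt_eqF//.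
    by apply: fine_ge0; have /andP[/ltW] := W0 i.
  rewrite muleCA lee_wpmul2l ?lee_fin//.
  by rewrite lee_pdivlMl// Eeta.
apply: (@le_trans _ _ (\sum_(P <- s) eta^-1%:E * ((v P)%:E * mu (E P)))).
  by rewrite !big_seq; apply: lee_sum.
rewrite -ge0_sume_distrr; last by move=> P _; rewrite mule_ge0 ?lee_fin.
rewrite EFinM -muleA lee_wpmul2l ?lee_fin ?invr_ge0 ?(ltW eta0)//.
apply: le_trans numden.
(* Extending by the empty set makes the sets measurable for every index, not only on [s]. *)
pose F P := if P \in s then E P else set0.
have mF P : measurable (F P).
  rewrite /F; have [Ps|_] := boolP (P \in s); last exact: measurable0.
  by apply: mE; case: (sS _ Ps).
have FQ P : F P `<=` Q.
  rewrite /F; have [Ps|_] := boolP (P \in s); last exact: sub0set.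
  by have [SP PQ _] := sS _ Ps; apply: subset_trans PQ; exact: EQ.
have -> : \sum_(P <- s) (v P)%:E * mu (E P) =
    \int[mu]_(x in Q) \sum_(P <- s) (v P)%:E * (\1_(F P) x)%:E.
  rewrite ge0_integral_sum//; last 3 first.
  - exact: mD.
  - move=> P; apply: measurable_funeM; apply/measurable_EFinP.
    exact: measurable_indic.
  - by move=> P x _; rewrite mule_ge0 ?lee_fin.
  apply: eq_big_seq => P Ps; rewrite ge0_integralZl_EFin//; last 2 first.
  - exact: mD.
  - by apply/measurable_EFinP; exact: measurable_indic.
  rewrite integral_indic//; last exact: mD.
  by rewrite (setIidl (FQ P)) /F Ps.
apply: le_ge0_integral => x Qx.
  by apply: sume_ge0 => P _; rewrite mule_ge0 ?lee_fin.
(* By disjointness at most one term is non-zero at [x]; its value [v P] is one of the products in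
   the supremum that defines the maximal function. *)
have [[P Ps FPx]|noP] := pselect (exists2 P, P \in s & F P x); last first.
  rewrite big_seq big1 ?maximal_op_ge0// => P Ps.
  by rewrite indicE memNset ?mule0// => FPx; apply: noP; exists P.
have [SP PQ _] := sS _ Ps.
have EPx : E P x by move: FPx; rewrite /F Ps.
rewrite (bigD1_seq P)//= big_seq_cond big1 ?adde0; last first.
  move=> P' /andP[P's P'P]; rewrite indicE memNset ?mule0// /F P's => EP'x.
  move/eqP: P'P; apply; apply: triE => //; first by case: (sS _ P's).
  by exists x.
rewrite indicE mem_set// mule1 vE//; apply: maximal_op_ge => //; first exact: SD.
exact: EQ EPx.
Qed.

End Characteristics.

(** * The sparse operator *)

Section SparseOperator.
Context d (X : measurableType d) (R : realType).
Local Open Scope ereal_scope.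

(** For [p <= 1] the p-th power moves inside the sum, the integral is taken termwise, and a sum over
    [D] is the supremum of its finite partial sums. *)
Lemma Lnorm_esum_le (nu : {measure set X -> \bar R}) (D : set (set X))
    (a : set X -> \bar R) (p : R) (K : \bar R) :
  countable D -> (forall Q, D Q -> measurable Q) -> (forall Q, 0 <= a Q) ->
  (0 < p)%R -> (p <= 1)%R -> 0 <= K ->
  (forall s : seq (set X), uniq s -> {in s, forall Q, D Q} ->
    \sum_(Q <- s) a Q `^ p * nu Q <= K `^ p) ->
  Lnorm nu p%:E (fun x => \esum_(Q in D) (a Q * (\1_Q x)%:E)) <= K.
Proof.
move=> cD mD a0 p0 p1 K0 H; rewrite unlock.
have a10 Q x : 0 <= a Q * (\1_Q x)%:E by rewrite mule_ge0// lee_fin.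
rewrite -[leRHS]poweRe1// -(divff (x := p)) ?gt_eqF// poweRrM.
apply: le_poweR2; first by rewrite invr_ge0 ltW.
  by apply: integral_ge0 => x _; exact: poweR_ge0.
apply: (@le_trans _ _ (\int[nu]_x (\esum_(Q in D) (a Q `^ p * (\1_Q x)%:E)))).
  apply: le_ge0_integral => x _; first exact: poweR_ge0.
  rewrite gee0_abs ?esum_ge0//; apply: le_trans (esum_poweR_le _ p0 p1 _) _ => //.
  apply: le_esum => Q _; rewrite poweRM ?lee_fin// poweR_EFin indicE.
  by case: (x \in Q); rewrite ?powR1// powR0 ?gt_eqF.
rewrite ge0_integral_esum//; last 2 first.
- by move=> Q x; rewrite mule_ge0 ?poweR_ge0 ?lee_fin.
- move=> Q DQ; apply: measurable_funeM; apply/measurable_EFinP.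
  by apply: measurable_indic; exact: mD.
apply: ge_ereal_sup => _ [A [finA AD] <-]; rewrite fsbig_finite//=.
have inA Q : Q \in finmap.enum_fset (fset_set A) -> D Q.
  by rewrite in_fset_set// inE => /AD.
apply: le_trans (H _ (finmap.fset_uniq _) inA).
rewrite !big_seq; apply: lee_sum => Q /inA DQ.
rewrite ge0_integralZl//; last 2 first.
- by apply/measurable_EFinP; apply: measurable_indic; exact: mD.
- exact: poweR_ge0.
by rewrite integral_indic ?setIT//; exact: mD.
Qed.

Variables (mu : {measure set X -> \bar R}) (D S : set (set X)) (n : nat).
Variables (r rho t : 'I_n -> R) (eta : R).
Variables (w : 'I_n.+1 -> X -> \bar R) (f : 'I_n -> X -> \bar R).
Hypothesis r0 : forall i, (0 < r i)%R.
Hypothesis rho0 : forall i, (0 <= rho i)%R.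
Hypothesis t1 : forall i, (1 < t i)%R.
Hypothesis rhot : forall i, (rho i < 1 / t i)%R.
Hypothesis eta0 : (0 < eta)%R.
Hypothesis hD : dyadic_grid mu D.
Hypothesis SD : S `<=` D.
Hypothesis sparseS : sparse mu eta S.
Hypothesis hw : forall i, nonneg_measurable (w i).
Hypothesis hf : forall i, nonneg_measurable (f i).

Let beta i := (r i * (1 / t i - rho i))%R.
Let alpha := (\sum_(i < n) beta i)%R.
Hypothesis alpha0 : (0 < alpha)%R.
Let q := snoc (fun i : 'I_n => r i / conj_exp (t i))%R alpha.
Let W i Q := \int[mu]_(x in Q) w (lift ord_max i) x.
Let Wm Q := \int[mu]_(x in Q) w ord_max x.
Let F i Q := \int[mu]_(x in Q) (f i x * w (lift ord_max i) x).
Let nu i := wmeasure mu (hw (lift ord_max i)).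
Let term Q := \prod_(i < n) (mu Q `^ (- (1 - rho i)) * F i Q) `^ r i.
(** The only cubes that can contribute: off [S], or when some weight has no mass on [Q], the summand
    vanishes. *)
Let good Q := [&& Q \in S, [forall i, W i Q != 0] & Wm Q != 0].

Let t0 i : (0 < t i)%R. Proof. exact: lt_trans (t1 i). Qed.

Let conj_gt0 i : (0 < conj_exp (t i))%R.
Proof. by rewrite divr_gt0// subr_gt0. Qed.

Let beta0 i : (0 < beta i)%R.
Proof. by rewrite mulr_gt0// subr_gt0. Qed.

Let mD Q : D Q -> measurable Q.
Proof. by have [_ + _ _] := hD; exact. Qed.

Let F0 i Q : 0 <= F i Q.
Proof.
by apply: integral_ge0 => x _; rewrite mule_ge0//; [exact: (hf _).2|exact: (hw _).2].
Qed.

Let W0 i Q : 0 <= W i Q.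
Proof. by apply: integral_ge0 => x _; exact: (hw _).2. Qed.

Let Wm0 Q : 0 <= Wm Q.
Proof. by apply: integral_ge0 => x _; exact: (hw _).2. Qed.

Let FE i Q : D Q -> F i Q = \int[nu i]_(x in Q) f i x.
Proof. by move=> DQ; rewrite /F -ge0_integral_wmeasure_in//; exact: mD. Qed.

Let term_eq0 i Q : F i Q = 0 -> term Q = 0.
Proof.
by move=> FQ; apply/prode_eq0P; exists i; rewrite FQ mule0 poweR0r// gt_eqF.
Qed.

Lemma sparse_term_weight_eq0 i Q : D Q -> W i Q = 0 -> term Q = 0.
Proof.
move=> DQ WQ; apply: (@term_eq0 i); rewrite FE//; apply: null_set_integral => //.
  exact: mD.
by apply: measurable_funTS; exact: (hf i).1.
Qed.

Let Lnorm_eq0 i Q : D Q -> 'N[nu i]_((t i)%:E)[f i] = 0 -> term Q = 0.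
Proof.
move=> DQ N0; apply: (@term_eq0 i); rewrite FE//.
rewrite (@ge0_ae_eq_integral _ _ _ _ _ _ (cst 0)) ?integral0//.
- exact: mD.
- by apply: measurable_funTS; exact: (hf i).1.
- by move=> x _; exact: (hf i).2.
- have := Lnorm_eq0_eq0 (hf i).1 _ N0; rewrite lte_fin t0 => /(_ isT).
  by apply: filterS => x H _; exact: H.
Qed.

Let muckenhoupt_ge Q : D Q ->
  \prod_(i < n) average mu Q (w (lift ord_max i)) `^ (r i / conj_exp (t i)) *
    average mu Q (w ord_max) `^ alpha <= muckenhoupt mu D q w.
Proof.
move=> DQ; apply: le_nnsup; exists Q => //; rewrite big_ord_lift_max/= /q snoc_max.
by congr (_ * _); apply: eq_bigr => i _; rewrite snoc_lift.
Qed.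

Let average_eq0 Q i : D Q -> average mu Q (w i) = 0 -> \int[mu]_(x in Q) w i x = 0.
Proof.
move=> DQ; rewrite (averageE hD)// => /eqP; rewrite mule_eq0 => /orP[|/eqP//].
by rewrite eqe invr_eq0 gt_eqF// (grid_measureE hD DQ).2.
Qed.

Let average_ge0 Q i : D Q -> 0 <= average mu Q (w i).
Proof.
move=> DQ; rewrite (averageE hD)// mule_ge0 ?lee_fin ?invr_ge0 ?(ltW (grid_measureE hD DQ).2)//.
by apply: integral_ge0 => x _; exact: (hw _).2.
Qed.

(** Settles the case of a zero right-hand side. A vanishing norm annihilates the integral of
    [f_i w_i], a vanishing Muckenhoupt characteristic annihilates some weight on [Q], and the
    Fujii-Wilson characteristic is non-zero once all [W i Q] are. *)
Lemma sparse_term_eq0 Q : D Q ->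
  muckenhoupt mu D q w * fujii_wilson mu D (snoc beta 0%R) w *
    \prod_(i < n) 'N[nu i]_((t i)%:E)[f i] `^ r i = 0 ->
  term Q = 0 \/ Wm Q = 0.
Proof.
move=> DQ /eqP; rewrite mule_eq0 => /orP[|/eqP]; last first.
  move=> /prode_eq0P[i /(poweR_eq0_eq0 (Lnorm_ge0 _ _ _)) Ni].
  by left; exact: Lnorm_eq0 Ni.
have [[i Wi] _|WN0] := pselect (exists i, W i Q = 0).
  by left; exact: sparse_term_weight_eq0 Wi.
rewrite mule_eq0 => /orP[/eqP Mk0|/eqP FW0]; last first.
  exfalso; apply: (fujii_wilson_eq0 hD beta0 hw alpha0 DQ _ FW0) => i.
  by apply/eqP => Wi; apply: WN0; exists i.
have := muckenhoupt_ge DQ; rewrite Mk0 => H.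
have /eqP : \prod_(i < n) average mu Q (w (lift ord_max i)) `^ (r i / conj_exp (t i)) *
    average mu Q (w ord_max) `^ alpha = 0.
  apply/eqP; rewrite eq_le H mule_ge0 ?poweR_ge0//.
  by apply: prode_ge0 => i _; exact: poweR_ge0.
rewrite mule_eq0 => /orP[/eqP/prode_eq0P[i Hi]|/eqP Hi].
  have /(average_eq0 DQ) Wi := poweR_eq0_eq0 (average_ge0 _ DQ) Hi.
  by left; exact: sparse_term_weight_eq0 Wi.
by have /(average_eq0 DQ) := poweR_eq0_eq0 (average_ge0 _ DQ) Hi; right.
Qed.

(** No average on a good cube is 0, so the convention [0 * +oo = 0] cannot hide an infinite one from
    the finite Muckenhoupt product. *)
Let good_lty (Mk : R) Q : D Q -> muckenhoupt mu D q w = Mk%:E -> good Q ->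
  (forall i, 0 < W i Q < +oo) /\ 0 < Wm Q < +oo.
Proof.
move=> DQ MkE /and3P[_ /forallP WN0 WmN0]; have mQ0 := (grid_measureE hD DQ).2.
have W1 i : 0 < W i Q by rewrite lt0e WN0 W0.
have Wm1 : 0 < Wm Q by rewrite lt0e WmN0 Wm0.
have ag i : 0 < \int[mu]_(x in Q) w i x -> 0 < average mu Q (w i).
  by move=> H; rewrite (averageE hD)// mule_gt0// lte_fin invr_gt0.
have ai i (p : R) : (0 < p)%R -> \int[mu]_(x in Q) w i x = +oo ->
    average mu Q (w i) `^ p = +oo.
  move=> p0 H; rewrite (averageE hD)// H gt0_muley ?lte_fin ?invr_gt0//.
  by rewrite poweRyr// gt_eqF.
have := muckenhoupt_ge DQ; rewrite MkE.
set P := \prod_(i < n) _; set Am := _ `^ alpha.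
have P0 : 0 < P.
  rewrite lt0e prode_ge0 ?andbT; last by move=> i _; exact: poweR_ge0.
  apply/eqP => /prode_eq0P[i /(poweR_eq0_eq0 (average_ge0 _ DQ)) Ai].
  by have := ag _ (W1 i); rewrite Ai ltxx.
have Am0 : 0 < Am by apply: poweR_gt0; exact: ag.
move=> PAm; split => [i|]; apply/andP; split => //; rewrite ltey; apply/eqP => Wy.
  move: PAm; rewrite leNgt => /negP; apply; rewrite /P (bigD1 i)//= ai//; last first.
    by rewrite divr_gt0.
  rewrite gt0_mulye; last first.
    rewrite lt0e prode_ge0 ?andbT; last by move=> j _; exact: poweR_ge0.
    apply: contraTneq P0 => P0; rewrite /P (bigD1 i)//= P0 mule0.
    by rewrite ltxx.
  by rewrite gt0_mulye// ltry.
by move: PAm; rewrite /Am (ai _ _ alpha0 Wy) gt0_muley// leye_eq.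
Qed.

(** The non-degenerate case on finitely many cubes: each term is at most [H * G Q * a Q], the [a Q]
    are packed with constant [K1], and [A] bounds the integral of the maximal function of [G]. *)
Lemma sparse_sum_le (Mk phi : R) (N : 'I_n -> R) (s : seq (set X)) :
  (0 < Mk)%R -> (0 < phi)%R -> (forall i, 0 < N i)%R ->
  muckenhoupt mu D q w = Mk%:E ->
  fujii_wilson mu D (snoc beta 0%R) w = phi%:E ->
  (forall i, 'N[nu i]_((t i)%:E)[f i] = (N i)%:E) ->
  uniq s -> {in s, forall Q, D Q} -> {in s, forall Q, good Q} ->
  \sum_(Q <- s) term Q `^ (1 / alpha) * Wm Q <=
  ((eta `^ (- alpha) * \prod_(i < n) conj_exp (t i) `^ r i *
    (Mk * phi * \prod_(i < n) N i `^ r i)) `^ (1 / alpha))%:E.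
Proof.
move=> Mk0 phi0 N0 MkE phiE NE us sD sgood.
have sW Q : Q \in s -> (forall i, 0 < W i Q < +oo) /\ 0 < Wm Q < +oo.
  by move=> Qs; exact: good_lty (sD _ Qs) MkE (sgood _ Qs).
have sS Q : Q \in s -> S Q by move=> /sgood /and3P[/set_mem].
have ns : nested s.
  by move=> Q Q' /sD DQ /sD DQ'; have [_ _ _ +] := hD; exact.
have ms : {in s, forall Q, measurable Q} by move=> Q /sD /mD.
pose theta i := (beta i / alpha)%R.
(* The factor [conj_exp (t i)] is the constant in Doob's inequality. *)
pose N' i := (conj_exp (t i) * N i)%R.
have N'0 i : (0 < N' i)%R by rewrite mulr_gt0.
pose c i Q := (fine (\int[nu i]_(x in Q) f i x) / fine (nu i Q))%R.
have dob i := @doob_average _ X R (nu i) (f i) s (t i) (N i) ns ms us (hf i) (t1 i)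
  (fun Q Qs => (sW Q Qs).1 i) (NE i).
have WE i Q : Q \in s -> W i Q = (fine (W i Q))%:E /\ (0 < fine (W i Q))%R.
  move=> /sW[/(_ i)/andP[Wi0 Wioo] _].
  by rewrite fineK ?ge0_fin_numE ?(ltW Wi0)// fine_gt0 ?Wi0.
have WmE Q : Q \in s -> Wm Q = (fine (Wm Q))%:E /\ (0 < fine (Wm Q))%R.
  move=> /sW[_ /andP[Wi0 Wioo]].
  by rewrite fineK ?ge0_fin_numE ?(ltW Wi0)// fine_gt0 ?Wi0.
have FfE i Q : Q \in s -> F i Q = (fine (\int[nu i]_(x in Q) f i x))%:E.
  move=> Qs; rewrite FE; last exact: sD.
  by have [/(_ _ Qs) finF _ _] := dob i; rewrite fineK.
have Ff0 i Q : Q \in s -> (0 <= fine (\int[nu i]_(x in Q) f i x))%R.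
  by move=> Qs; rewrite -lee_fin -FfE.
have c0 i Q : Q \in s -> (0 <= c i Q)%R.
  by move=> Qs; rewrite divr_ge0 ?Ff0// ltW// (WE i Q Qs).2.
pose A := (\prod_(i < n) (N' i `^ t i) `^ theta i)%R.
pose B := (\prod_(i < n) N' i `^ (rho i * t i * r i / alpha))%R.
pose H := (Mk `^ (1 / alpha) * B)%R.
have H0 : (0 <= H)%R.
  by rewrite mulr_ge0 ?powR_ge0// prodr_ge0// => i _; exact: powR_ge0.
pose G Q := (\prod_(i < n) c i Q `^ (t i * theta i))%R.
pose a Q := (\prod_(i < n) fine (W i Q) `^ theta i)%R.
have a0 Q : (0 <= a Q)%R by apply: prodr_ge0 => i _; exact: powR_ge0.
have G0 Q : (0 <= G Q)%R by apply: prodr_ge0 => i _; exact: powR_ge0.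
have termE Q : Q \in s -> term Q `^ (1 / alpha) * Wm Q <= (H * (G Q * a Q))%:E.
  move=> Qs; have [mE m0] := grid_measureE hD (sD _ Qs).
  have mk : (\prod_(i < n) (fine (W i Q) / fine (mu Q)) `^ (r i / conj_exp (t i)) *
      (fine (Wm Q) / fine (mu Q)) `^ alpha <= Mk)%R.
    rewrite -lee_fin -MkE; apply: le_trans (muckenhoupt_ge (sD _ Qs)).
    rewrite EFinM -prodEFin (averageE hD); last exact: sD.
    rewrite -/(Wm Q) (WmE Q Qs).1 -EFinM poweR_EFin [(_ / fine (mu Q))%R]mulrC.
    apply: lee_wpmul2r; first by rewrite lee_fin powR_ge0.
    rewrite le_eqVlt; apply/orP; left; apply/eqP; apply: eq_bigr => i _.
    rewrite (averageE hD); last exact: sD.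
    by rewrite -/(W i Q) [in RHS](WE i Q Qs).1 -EFinM poweR_EFin mulrC.
  have := @testing_bound R n r rho t (fine (mu Q)) (fine (Wm Q)) Mk
    (fun i => fine (W i Q)) (fun i => fine (\int[nu i]_(x in Q) f i x)) N'
    r0 rho0 t1 alpha0 m0 (ltW (WmE Q Qs).2) (fun i => (WE i Q Qs).2)
    (fun i => Ff0 i Q Qs) N'0.
  move=> /(_ (fun i => let: And3 _ _ h := dob i in h Q Qs) mk) tb.
  apply: (@le_trans _ _ (\prod_(i < n) (fine (mu Q) `^ (- (1 - rho i)) *
    fine (\int[nu i]_(x in Q) f i x)) `^ (r i / alpha) * fine (Wm Q))%:E).
    rewrite /term poweR_prod; last by move=> i; exact: poweR_ge0.
    rewrite [in leLHS](WmE Q Qs).1 EFinM -prodEFin; apply: lee_wpmul2r.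
      by rewrite lee_fin ltW// (WmE Q Qs).2.
    rewrite le_eqVlt; apply/orP; left; apply/eqP; apply: eq_bigr => i _.
    rewrite FfE// [in LHS]mE (poweR_EFin (fine (mu Q))).
    by rewrite -EFinM -poweRrM poweR_EFin mulrA mulr1.
  by rewrite lee_fin.
pose K1 := (eta^-1 * phi `^ (1 / alpha))%R.
have K10 : (0 < K1)%R by rewrite mulr_gt0 ?invr_gt0 ?powR_gt0.
pose sigma := wmeasure mu (prod_weight_nonneg_measurable beta hw).
have carl : \sum_(Q <- s) (G Q)%:E * (a Q / K1)%:E <= \int[sigma]_x (max_on G s x)%:E.
  apply: carleson_embedding => //; first by move=> Q; rewrite lee_fin divr_ge0// ltW.
  move=> Q u Qs uu us' uQ.
  have -> : \sum_(P <- u) (a P / K1)%:E = K1^-1%:E * \sum_(P <- u) (a P)%:E.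
    rewrite ge0_sume_distrr; last by move=> P _; rewrite lee_fin.
    by apply: eq_bigr => P _; rewrite -EFinM mulrC.
  rewrite lee_pdivrMl//.
  have ub : {in u, forall P, [/\ S P, P `<=` Q & forall i, 0 < W i P < +oo]}.
    move=> P Pu; split; [exact/sS/us'|exact: uQ|].
    by move=> i; have [/(_ i)] := sW _ (us' _ Pu).
  exact: (sparse_carleson hD hw alpha0 eta0 phi0 SD sparseS phiE (sD _ Qs) uu ub).
pose M i x := max_on (c i) s x.
have hM i : nonneg_measurable (fun x => (M i x `^ t i)%:E).
  split; last by move=> x; rewrite lee_fin powR_ge0.
  apply/measurable_EFinP.
  exact: (measurableT_comp (measurable_powR (t i)) (measurable_max_on _ ms)).
have theta0 i : (0 < theta i)%R by rewrite divr_gt0.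
have maxG : \int[sigma]_x (max_on G s x)%:E <= A%:E.
  rewrite ge0_integral_wmeasure; last first.
    split; last by move=> x; rewrite lee_fin max_on_ge0.
    by apply/measurable_EFinP; exact: measurable_max_on.
  apply: (@le_trans _ _ (\int[mu]_x \prod_(i < n)
      ((M i x `^ t i)%:E * w (lift ord_max i) x) `^ theta i)).
    have wp0 x : 0 <= \prod_(i < n) w (lift ord_max i) x `^ theta i.
      by apply: prode_ge0 => i _; exact: poweR_ge0.
    apply: le_ge0_integral => x _; first by rewrite mule_ge0// lee_fin max_on_ge0.
    have -> : \prod_(i < n) ((M i x `^ t i)%:E * w (lift ord_max i) x) `^ theta i =
        (\prod_(i < n) (M i x `^ t i) `^ theta i)%:E *
        \prod_(i < n) w (lift ord_max i) x `^ theta i.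
      rewrite -prodEFin -big_split/=; apply: eq_bigr => i _.
      by rewrite poweRM ?lee_fin ?powR_ge0//; exact: (hw _).2.
    apply: lee_wpmul2r; first exact: wp0.
    (* At each point the maximum of [G] is attained at a single cube, where every factor is at most
       its own maximal function. *)
    have [->|[Q [Qs Qx ->]]] := max_on_attained G s x.
      by rewrite lee_fin prodr_ge0// => i _; exact: powR_ge0.
    rewrite lee_fin; apply: ler_prod => i _; rewrite powR_ge0/= -powRrM.
    have ti0 : (0 <= t i * theta i)%R by rewrite mulr_ge0// ltW.
    rewrite ge0_ler_powR ?nnegrE ?max_on_ge0 ?c0//.
    exact: le_max_on.
  apply: ge0_integral_prod_poweR_le => //.
  - by rewrite /theta -mulr_suml divff// gt_eqF.
  - by move=> i; exact: powR_gt0.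
  - move=> i; split; first by apply: emeasurable_funM; [exact: (hM i).1|exact: (hw _).1].
    by move=> x; rewrite mule_ge0 ?(hM i).2//; exact: (hw _).2.
  - by move=> i; rewrite -(ge0_integral_wmeasure mu (hw _) (hM i)); have [] := dob i.
apply: (@le_trans _ _ (\sum_(Q <- s) (H * K1)%:E * ((G Q)%:E * (a Q / K1)%:E))).
  rewrite !big_seq; apply: lee_sum => Q Qs; apply: le_trans (termE _ Qs) _.
  rewrite -!EFinM lee_fin le_eqVlt; apply/orP; left; apply/eqP.
  by field; rewrite gt_eqF.
rewrite -ge0_sume_distrr; last by move=> Q _; rewrite -EFinM lee_fin mulr_ge0// divr_ge0// ltW.
apply: le_trans (lee_wpmul2l _ (le_trans carl maxG)) _.
  by rewrite lee_fin mulr_ge0// ltW.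
rewrite -EFinM lee_fin /H /K1.
have prN (x : 'I_n -> R) (y : 'I_n -> R) : (0 <= \prod_(i < n) x i `^ y i)%R.
  by apply: prodr_ge0 => i _; exact: powR_ge0.
rewrite !powRM ?mulr_ge0 ?powR_ge0 ?prN ?(ltW Mk0) ?(ltW phi0)//.
have -> : ((eta `^ (- alpha)) `^ (1 / alpha) = eta^-1)%R.
  by rewrite -powRrM mulNr mulrCA divff ?gt_eqF// mulr1 powR_inv1 ?ltW.
(* The two exponents of [N' i] add up: [rho t r / alpha + t theta = r / alpha]. *)
have BA : (B * A = (\prod_(i < n) conj_exp (t i) `^ r i) `^ (1 / alpha) *
                   (\prod_(i < n) N i `^ r i) `^ (1 / alpha))%R.
  rewrite !powR_prod; last 2 first.
  - by move=> i; exact: powR_ge0.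
  - by move=> i; exact: powR_ge0.
  rewrite /B /A -!big_split/=; apply: eq_bigr => i _.
  rewrite -!powRrM -powRM ?(ltW (N0 i)) ?(ltW (conj_gt0 i))// -powRD; last first.
    by apply/implyP => _; rewrite gt_eqF.
  by congr (_ `^ _)%R; rewrite /theta /beta; field; rewrite !gt_eqF.
have assoc (x b y z a' p1 p2 : R) : (b * a' = p1 * p2 ->
    x * b * (y * z) * a' <= y * p1 * (x * z * p2))%R.
  move=> E; have -> : (y * p1 * (x * z * p2) = x * y * z * (p1 * p2))%R by ring.
  by rewrite -E le_eqVlt; apply/orP; left; apply/eqP; ring.
exact: assoc BA.
Qed.

End SparseOperator.

(** * Reduction of the theorem to positive finite characteristics and norms *)

Lemma mule_gt0_lty (R : realDomainType) (x y : \bar R) :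
  (0 <= x -> 0 <= y -> x * y != 0 -> x * y != +oo ->
   (0 < x < +oo) /\ (0 < y < +oo))%E.
Proof.
move=> x0 y0; rewrite mule_eq0 negb_or => /andP[xN0 yN0] xyoo.
have {x0}x0 : (0 < x)%E by rewrite lt0e xN0.
have {y0}y0 : (0 < y)%E by rewrite lt0e yN0.
rewrite x0 y0 !ltey; split; apply: contra xyoo => /eqP ->.
  by rewrite gt0_mulye.
by rewrite gt0_muley.
Qed.

(* n = m - 1; the weight w_m is w ord_max and w_i, i < m, is
   w (lift ord_max i). *)
Theorem theorem1p12 (R : realType) (n : nat) (r rho t : 'I_n -> R) (eta : R)
  (hn : (1 <= n)%N)
  (hr : forall i, 0 < r i)
  (hrho : forall i, 0 <= rho i /\ rho i < 1)
  (ht : forall i, 1 < t i /\ ((t i)%:E < ((rho i)%:E)^-1)%E)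
  (heta : 0 < eta /\ eta <= 1) :
  let beta := fun i : 'I_n => r i * (1 / t i - rho i) in
  let alpha := \sum_(i < n) beta i in
  let q := snoc (fun i : 'I_n => r i / conj_exp (t i)) alpha in
  1 <= alpha ->
  exists C : R, 0 < C /\
    forall (d : measure_display) (X : measurableType d)
      (mu : {measure set X -> \bar R}) (D S : set (set X)),
      nonatomic mu -> dyadic_grid mu D -> S `<=` D -> sparse mu eta S ->
    forall (w : 'I_n.+1 -> X -> \bar R)
      (hw : forall i, nonneg_measurable (w i))
      (f : 'I_n -> X -> \bar R),
      (forall i, nonneg_measurable (f i)) ->
      ('N[wmeasure mu (hw ord_max)]_((1 / alpha)%:E)
          [sparse_op mu D r rho (\1_S)
             (fun i x => f i x * w (lift ord_max i) x)]
       <= C%:E *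
          (muckenhoupt mu D q w *
           fujii_wilson mu D (snoc beta 0%R) w *
           \prod_(i < n)
             'N[wmeasure mu (hw (lift ord_max i))]_((t i)%:E)[f i] `^ r i))%E.
Proof.
move=> beta alpha q alpha1.
have alpha0 : 0 < alpha by apply: lt_le_trans alpha1.
have t1 i : 1 < t i := (ht i).1.
have rho0 i : 0 <= rho i := (hrho i).1.
have rhot i : rho i < 1 / t i.
  have [_ +] := ht i; have t0 := lt_trans ltr01 (t1 i).
  (* The case [rho i = 0] is separate, since its extended inverse is infinite. *)
  rewrite div1r; have := rho0 i; rewrite le_eqVlt => /predU1P[<- _|r0].
    by rewrite invr_gt0.
  by rewrite inver gt_eqF// lte_fin -ltf_pV2 ?posrE ?invr_gt0// invrK.
have conj_gt0 i : 0 < conj_exp (t i).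
  by rewrite divr_gt0// ?subr_gt0// (lt_trans ltr01).
have [eta0 _] := heta.
(* The power of [eta] comes from sparseness and the conjugate exponents from Doob's inequality. *)
pose C := eta `^ (- alpha) * \prod_(i < n) conj_exp (t i) `^ r i.
have C0 : 0 < C.
  by rewrite mulr_gt0 ?powR_gt0// prodr_gt0// => i _; rewrite powR_gt0.
exists C; split=> // d X mu D S _ hD SD sparseS w hw f hf.
set Mk := muckenhoupt mu D q w; set FW := fujii_wilson mu D _ w.
set PN := (\prod_(i < n) _)%E.
have Mk0 : (0 <= Mk)%E by exact: nnsup_ge0.
have FW0 : (0 <= FW)%E by exact: nnsup_ge0.
have PN0 : (0 <= PN)%E by apply: prode_ge0 => i _; exact: poweR_ge0.
have T0 : (0 <= Mk * FW * PN)%E by rewrite !mule_ge0.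
have K0 : (0 <= C%:E * (Mk * FW * PN))%E by rewrite mule_ge0// lee_fin ltW.
have p0 : 0 < 1 / alpha by rewrite divr_gt0.
pose term Q := (\prod_(i < n) (mu Q `^ (- (1 - rho i)) *
  \int[mu]_(y in Q) (f i y * w (lift ord_max i) y)) `^ r i)%E.
have term0 Q : (0 <= term Q)%E by apply: prode_ge0 => i _; exact: poweR_ge0.
have [cD mD _ _] := hD.
(* The indicator of [S] joins the coefficients; [1 <= alpha] makes the exponent [1 / alpha] at most
   1. *)
apply: (@Lnorm_esum_le _ _ _ _ _ (fun Q => (\1_S Q)%:E * term Q)%E) => //.
- by move=> Q; rewrite mule_ge0// lee_fin.
- by rewrite ler_pdivrMr// mul1r.
move=> s us sD.
have [TE|TN0] := eqVneq (Mk * FW * PN)%E 0%E.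
  rewrite big_seq big1 ?poweR_ge0// => Q /sD DQ.
  have [/= tE|/= wE] := sparse_term_eq0 hr t1 rhot hD hf alpha0 DQ TE.
    by rewrite /term tE mule0 poweR0r ?gt_eqF// mul0e.
  by rewrite /wmeasure wE mule0.
have [Ty|Tfin] := eqVneq (Mk * FW * PN)%E +oo%E.
  by rewrite Ty gt0_muley ?lte_fin// poweRyr ?gt_eqF// leey.
(* A product that is neither 0 nor infinite has only positive finite factors, so all quantities
   become positive reals. *)
have [/andP[MF0 MFoo] PNb] := mule_gt0_lty (mule_ge0 Mk0 FW0) PN0 TN0 Tfin.
have MFfin : (Mk * FW)%E != +oo%E by rewrite -ltey.
have [/andP[Mk1 Mkoo] /andP[FW1 FWoo]] :=
  mule_gt0_lty Mk0 FW0 (negbT (gt_eqF MF0)) MFfin.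
have NE i : (0 < 'N[wmeasure mu (hw (lift ord_max i))]_((t i)%:E)[f i] < +oo)%E.
  have [PN1 PNoo] := andP PNb; set Ni := 'N[_]_(_)[_]%E.
  have Ni0 : Ni != 0%E.
    apply/eqP => Ni0; move: PN1; rewrite /PN (bigD1 i)//= -/Ni Ni0.
    by rewrite poweR0r ?gt_eqF// mul0e ltxx.
  have N0 : (0 <= Ni)%E by exact: Lnorm_ge0.
  rewrite lt0e Ni0 N0/=; apply: (@lty_poweRy _ _ (r i)); first by rewrite gt_eqF.
  move: PN1 PNoo; rewrite /PN (bigD1 i)//= -/Ni => P1 Poo.
  have R0 : (0 <= \prod_(j < n | j != i)
      'N[wmeasure mu (hw (lift ord_max j))]_((t j)%:E)[f j] `^ r j)%E.
    by apply: prode_ge0 => j _; exact: poweR_ge0.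
  have [/andP[_ //]] := mule_gt0_lty (poweR_ge0 _ _) R0 (negbT (gt_eqF P1)) (negbT (lt_eqF Poo)).
pose N i := fine 'N[wmeasure mu (hw (lift ord_max i))]_((t i)%:E)[f i]%E.
have NfE i : 'N[wmeasure mu (hw (lift ord_max i))]_((t i)%:E)[f i]%E = (N i)%:E.
  by have /andP[? ?] := NE i; rewrite fineK// ge0_fin_numE ?ltW.
have MkE : Mk = (fine Mk)%:E by rewrite fineK// ge0_fin_numE.
have FWE : FW = (fine FW)%:E by rewrite fineK// ge0_fin_numE.
pose good Q := [&& Q \in S,
  [forall i, \int[mu]_(x in Q) w (lift ord_max i) x != 0]%E &
  \int[mu]_(x in Q) w ord_max x != 0]%E.
rewrite (bigID good)/= [X in (_ + X)%E]big_seq_cond [X in (_ + X)%E]big1 ?adde0; last first.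
  move=> Q /andP[/sD DQ]; rewrite /good.
  have [QS|QS] := boolP (Q \in S); last first.
    by move=> _; rewrite indicE (negbTE QS) mul0e poweR0r ?gt_eqF// mul0e.
  rewrite andTb negb_and => /orP[/forallPn[i Wi]|Wm].
  - move: Wi; rewrite negbK => /eqP Wi.
    rewrite /term (sparse_term_weight_eq0 rho hr hD hw hf DQ Wi).
    by rewrite mule0 poweR0r ?gt_eqF// mul0e.
  - by move: Wm; rewrite negbK => /eqP Wm; rewrite /wmeasure Wm mule0.
rewrite -big_filter.
have sgood : {in seq.filter good s, forall Q, good Q}.
  by move=> Q; rewrite mem_filter => /andP[].
have sD' : {in seq.filter good s, forall Q, D Q}.
  by move=> Q; rewrite mem_filter => /andP[_ /sD].
rewrite (eq_big_seq (fun Q => term Q `^ (1 / alpha) * \int[mu]_(x in Q) w ord_max x)%E); last first.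
  by move=> Q /sgood /and3P[QS _ _]; rewrite indicE QS mul1e.
have N0 i : 0 < N i by rewrite -lte_fin -NfE; have /andP[] := NE i.
have FW1' : 0 < fine FW by rewrite -lte_fin -FWE.
have Mk1' : 0 < fine Mk by rewrite -lte_fin -MkE.
have := sparse_sum_le hr rho0 t1 rhot eta0 hD SD sparseS hf alpha0 Mk1' FW1' N0
  MkE FWE NfE (filter_uniq _ us) sD' sgood.
move/le_trans; apply.
rewrite MkE FWE /PN; under [in leRHS]eq_bigr do rewrite NfE poweR_EFin.
by rewrite prodEFin -!EFinM poweR_EFin.
Qed.
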